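(* Let $\delta\in(0,n]$. (i) If $f\in \mathrm{BLO}(\mathbb R^n,\mathcal H_\infty^\delta)$ with $\|f\|_{\mathrm{BLO}(\mathbb R^n,\mathcal H_\infty^\delta)}\ne0$, then there exist a positive constant $\alpha$, a function $b\in L^\infty(\mathbb R^n,\mathcal H_\infty^\delta)$ and a function $g\in L^1_{\rm loc}(\mathbb R^n,\mathcal H_\infty^\delta)$ such that $$f=\alpha\ln\mathcal M_{\mathcal H_\infty^\delta}g+b\quad\text{and}\quad \alpha+\|b\|_{L^\infty(\mathbb R^n,\mathcal H_\infty^\delta)}\le C\|f\|_{\mathrm{BLO}(\mathbb R^n,\mathcal H_\infty^\delta)},$$ where $C$ is a positive constant depending only on $n$ and $\delta$. (ii) Conversely, let $\alpha\in(0,\infty)$, $b\in L^\infty(\mathbb R^n,\mathcal H_\infty^\delta)$ and $g\in L^1_{\rm loc}(\mathbb R^n,\mathcal H_\infty^\delta)$. If $\mathcal M_{\mathcal H_\infty^\delta}g(x)<\infty$ for $\mathcal H_\infty^\delta$-almost every $x\in\mathbb R^n$, then $$f:=\alpha\ln\mathcal M_{\mathcal H_\infty^\delta}g+b\in \mathrm{BLO}(\mathbb R^n,\mathcal H_\infty^\delta)$$ and there exists a positive constant $C$ depending only on $n$ and $\delta$ such that $$\|f\|_{\mathrm{BLO}(\mathbb R^n,\mathcal H_\infty^\delta)}\le C\left(\alpha+\|b\|_{L^\infty(\mathbb R^n,\mathcal H_\infty^\delta)}\right).$$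
   Context: A cube $Q\subset\mathbb R^n$ is always left-open and right-closed with sides parallel to the coordinate axes; $l(Q)$ is its edge length. For $\delta\in(0,n]$ and $E\subset\mathbb R^n$ the Hausdorff content is $\mathcal H_\infty^\delta(E)=\inf\{\sum_i l(Q_i)^\delta: E\subset\bigcup_iQ_i\}$, the infimum over all finite or countable coverings by cubes. For any (not necessarily measurable) $f\ge0$, the Choquet integral is $\int_E f(x)\,d\mathcal H_\infty^\delta=\int_0^\infty\mathcal H_\infty^\delta(\{x\in E:f(x)>t\})\,dt$. $L^1_{\rm loc}(\mathbb R^n,\mathcal H_\infty^\delta)$ is the set of functions $f$ with $\int_K|f|\,d\mathcal H_\infty^\delta<\infty$ for every compact $K\subset\mathbb R^n$. ''$\mathcal H_\infty^\delta$-almost every'' means outside a set of content zero. $\ln$ is the logarithm with base $e$. $\|f\|_{L^\infty(\mathbb R^n,\mathcal H_\infty^\delta)}=\inf\{t\in(0,\infty):\mathcal H_\infty^\delta(\{x\in\mathbb R^n:|f(x)|>t\})=0\}$, and $L^\infty(\mathbb R^n,\mathcal H_\infty^\delta)$ is the set of functions for which this is finite. The capacitary Hardy–Littlewood maximal operator is $\mathcal M_{\mathcal H_\infty^\delta}f(x)=\sup_{Q\ni x}\frac1{\mathcal H_\infty^\delta(Q)}\int_Q|f(y)|\,d\mathcal H_\infty^\delta$, the supremum over all cubes $Q$ containing $x$. For a function $f$ and a cube $Q$, $\operatorname{ess\,inf}_{y\in Q}f(y)=\inf\{t\in\mathbb R:\mathcal H_\infty^\delta(\{x\in Q:f(x)<t\})>0\}$.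 $\mathrm{BLO}(\mathbb R^n,\mathcal H_\infty^\delta)$ is the set of $f\in L^1_{\rm loc}(\mathbb R^n,\mathcal H_\infty^\delta)$ with $$\|f\|_{\mathrm{BLO}(\mathbb R^n,\mathcal H_\infty^\delta)}=\sup_Q\frac1{\mathcal H_\infty^\delta(Q)}\int_Q\left|f(x)-\operatorname*{ess\,inf}_{y\in Q}f(y)\right|d\mathcal H_\infty^\delta<\infty,$$ the supremum over all finite cubes $Q$.
   Formalization: In (ii), g is assumed not to vanish almost everywhere (with respect to the Hausdorff content), since otherwise Mg=0 and ln Mg is identically minus infinity; in (i), the identity f = α ln Mg + b is asserted almost everywhere, as pointwise equality fails e.g. for f=-ln|x| with f(0)=0. *)

(* Defs.v *)
From HB Require Import structures.
From mathcomp Require Import all_boot all_order all_algebra.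
From mathcomp Require Import all_classical all_reals all_analysis.
Import Order.TTheory GRing.Theory Num.Theory.
Import numFieldNormedType.Exports.

Set Implicit Arguments.
Unset Strict Implicit.
Unset Printing Implicit Defensive.

Local Open Scope classical_set_scope.
Local Open Scope ring_scope.

(* Functions on R^n take values in \bar R, because M f may be +oo at some
   points and ln (M f) is then +oo there. Conventions: lne 0 = -oo,
   lne +oo = +oo, and +oo + -oo = -oo. *)

(* Used only with 0 < l. *)
Definition cube (R : realType) (n : nat) (a : 'rV[R]_n) (l : R) :
    set 'rV[R]_n :=
  [set x | forall i, a 0 i < x 0 i <= a 0 i + l].

(* The index set D is an arbitrary subset of nat, so that finite (possibly
   empty) and countably infinite coverings are both allowed. *)
Definition hcontent (R : realType) (n : nat) (delta : R)
    (E : set 'rV[R]_n) : \bar R :=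
  ereal_inf [set s | exists (D : set nat) (a : nat -> 'rV[R]_n) (l : nat -> R),
    [/\ forall k, D k -> 0 < l k,
        E `<=` \bigcup_(k in D) cube (a k) (l k) &
        s = (\esum_(k in D) (l k `^ delta)%:E)%E]].

Definition hae (R : realType) (n : nat) (delta : R)
    (P : 'rV[R]_n -> Prop) : Prop :=
  hcontent delta [set x | ~ P x] = 0%E.

(* Meaningful for f >= 0. The integrand is nonincreasing in t, so the Lebesgue
   integral makes sense without any measurability assumption on f. *)
Definition choquet (R : realType) (n : nat) (delta : R) (E : set 'rV[R]_n)
    (f : 'rV[R]_n -> \bar R) : \bar R :=
  (\int[@lebesgue_measure R]_(t in `[0%R, +oo[)
     hcontent delta [set x | E x /\ t%:E < f x])%E.

Definition L1loc (R : realType) (n : nat) (delta : R)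
    (f : 'rV[R]_n -> \bar R) : Prop :=
  forall K : set 'rV[R]_n, compact K ->
    (choquet delta K (fun x => `|f x|%E) < +oo)%E.

Definition Linfty_norm (R : realType) (n : nat) (delta : R)
    (f : 'rV[R]_n -> \bar R) : \bar R :=
  ereal_inf [set t%:E | t in
    [set t : R | 0 < t /\ hcontent delta [set x | (t%:E < `|f x|)%E] = 0%E]].

Definition Linfty (R : realType) (n : nat) (delta : R)
    (f : 'rV[R]_n -> \bar R) : Prop :=
  (Linfty_norm delta f < +oo)%E.

Definition average (R : realType) (n : nat) (delta : R) (Q : set 'rV[R]_n)
    (f : 'rV[R]_n -> \bar R) : \bar R :=
  ((hcontent delta Q)^-1 * choquet delta Q f)%E.

Definition maximal (R : realType) (n : nat) (delta : R)
    (f : 'rV[R]_n -> \bar R) (x : 'rV[R]_n) : \bar R :=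
  ereal_sup [set s | exists (a : 'rV[R]_n) (l : R),
    [/\ 0 < l, cube a l x &
        s = average delta (cube a l) (fun y => `|f y|%E)]].

Definition hess_inf (R : realType) (n : nat) (delta : R) (Q : set 'rV[R]_n)
    (f : 'rV[R]_n -> \bar R) : \bar R :=
  ereal_inf [set t%:E | t in
    [set t : R | (0 < hcontent delta [set x | Q x /\ f x < t%:E])%E]].

Definition BLO_norm (R : realType) (n : nat) (delta : R)
    (f : 'rV[R]_n -> \bar R) : \bar R :=
  ereal_sup [set s | exists (a : 'rV[R]_n) (l : R),
    0 < l /\
    s = average delta (cube a l)
          (fun x => `|f x - hess_inf delta (cube a l) f|%E)].

Definition BLO (R : realType) (n : nat) (delta : R)
    (f : 'rV[R]_n -> \bar R) : Prop :=
  L1loc delta f /\ (BLO_norm delta f < +oo)%E.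

(* Main.v *)
(* Choquet integrals are handled through sums over levels, so only monotonicity and
   countable subadditivity of the content are ever needed.  The substitute for
   additivity is a stopping argument: given weights on dyadic cubes
   (a near-optimal dyadic covering), the maximal dyadic cubes whose total weight is
   large compared with their content are disjoint, so their contents add up to at
   most the total weight.

   (i) Applied to {f > ess inf_Q f + s}, the parents of the maximal cubes are not
   filled by the level set, which yields a John-Nirenberg inequality for f - ess inf_Q f.
   Hence g = exp (f / alpha), with alpha a large multiple of the BLO norm, has averages
   at most C exp (ess inf_Q f / alpha), so g / 2 <= M g <= C g almost everywhere and
   b = f - alpha ln (M g) is bounded.

   (ii) The same stopping argument, with coverings of all the sets {g > 2^k tau} at once,
   gives the weak type (1,1) of M.  Localized to a cube Q, with m = inf_Q M g, this gives
   H {x in Q : M g x > 2^k m} <= C 2^-k H(Q), and ln (M g / m) has bounded average. *)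
Require Import Defs.
From HB Require Import structures.
From mathcomp Require Import all_boot all_order all_algebra.
From mathcomp Require Import all_classical all_reals all_analysis.
From mathcomp Require Import measurable_realfun.
From mathcomp Require Import ring lra.
Import Order.TTheory GRing.Theory Num.Theory.
Import numFieldNormedType.Exports.

Set Implicit Arguments.
Unset Strict Implicit.
Unset Printing Implicit Defensive.

Local Open Scope classical_set_scope.
Local Open Scope ring_scope.

(** In [g / 2 <= M g] its role is taken by a density argument that loses a factor 2: a set filling
    less than half of every cube through its points is null.

    Averages are explicit because the content of a cube of side [l] is exactly [l^delta]; the lower
    bound is a comparison with volume, and this is where [delta <= n] enters. The dyadic grid is
    rooted at the cube to which an estimate is localized and has no coarser level, so a heavy cube
    always has a maximal heavy ancestor.

    In (ii), if [g] vanished almost everywhere, [M g] would be 0 and its logarithm [-oo].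
    Nontriviality of [g] makes [m = inf_Q M g] positive; up to the bound on [b], [alpha ln m] then
    lies below the essential infimum of [f] on [Q], and only the upper tail of [M g] remains to be
    estimated. *)

Section esum_extra.
Local Open Scope ereal_scope.
Context {R : realType}.

Lemma esum_subset {T : choiceType} (I J : set T) (a : T -> \bar R) :
  I `<=` J -> \esum_(i in I) a i <= \esum_(i in J) a i.
Proof.
move=> IJ; apply: ereal_sup_le => _ [X [finX XI] <-]; exists X => //.
by split => //; exact: subset_trans IJ.
Qed.

Lemma esum_ge_term {T : choiceType} (I : set T) (a : T -> \bar R) i :
  I i -> 0 <= a i -> a i <= \esum_(i in I) a i.
Proof.
by move=> Ii a0; rewrite -(esum_set1 a0); apply: esum_subset => _ ->.
Qed.

Lemma esumZl {T : choiceType} (I : set T) (a : T -> \bar R) (c : R) :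
  (0 < c)%R -> (forall i, 0 <= a i) ->
  \esum_(i in I) (c%:E * a i) = c%:E * \esum_(i in I) a i.
Proof.
have le (b : T -> \bar R) (d : R) : (0 < d)%R -> (forall i, 0 <= b i) ->
    \esum_(i in I) (d%:E * b i) <= d%:E * \esum_(i in I) b i.
  move=> d0 b0; apply: ge_ereal_sup => _ [X [finX XI] <-].
  rewrite -ge0_mule_fsumr//.
  apply: lee_wpmul2l; first by rewrite lee_fin ltW.
  by apply: ereal_sup_ubound; exists X.
move=> c0 a0; apply/eqP; rewrite eq_le le//=.
have ca0 i : 0 <= c%:E * a i by rewrite mule_ge0// lee_fin ltW.
have := le (fun i => c%:E * a i) c^-1%R.
rewrite invr_gt0 => /(_ c0 ca0).
under eq_esum do rewrite muleA -EFinM mulVf ?gt_eqF// mul1e.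
have c0' : 0 <= c%:E by rewrite lee_fin ltW.
by move=> /(lee_wpmul2l c0'); rewrite muleA -EFinM divff ?gt_eqF// mul1e.
Qed.

Lemma esum_finType {T : finType} (a : T -> \bar R) :
  (forall i, 0 <= a i) -> \esum_(i in [set: T]) a i = \sum_i a i.
Proof.
move=> a0; rewrite esum_fset//; last exact: finite_finset.
have -> : [set: T] = [set` enum T].
  by apply/seteqP; split=> // x _ /=; rewrite mem_enum.
by rewrite -fsbig_seq ?enum_uniq// big_enum.
Qed.

Lemma esum_fin_cst {T : finType} (c : R) :
  (0 <= c)%R -> \esum_(i in [set: T]) c%:E = (#|T|%:R * c)%:E.
Proof.
move=> c0; rewrite esum_finType; last by move=> _; rewrite lee_fin.
by rewrite sumEFin sumr_const mulr_natl.
Qed.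

Lemma esum_geometric (T : countType) (I : set T) (e : R) : (0 <= e)%R ->
  \esum_(i in I) (e / (2 ^ (choice.pickle i).+1)%:R)%:E <= e%:E.
Proof.
move=> e0; rewrite -(@esum_image _ _ _ I choice.pickle
  (fun k => (e / (2 ^ k.+1)%:R)%:E)); last first.
  by move=> i j _ _; apply: (pcan_inj choice.pickleK).
apply: (@le_trans _ _ (\esum_(k in [set: nat]) (e / (2 ^ k.+1)%:R)%:E)).
  exact: esum_subset.
by rewrite -nneseries_esumT ?epsilon_trick0// => k; rewrite lee_fin divr_ge0.
Qed.

End esum_extra.

(** * Monotonicity and countable subadditivity of the content *)

Section content.
Local Open Scope ereal_scope.
Context {R : realType} {n : nat}.
Implicit Types (delta : R) (E F : set 'rV[R]_n).

Lemma hcontent_ge0 delta E : 0 <= hcontent delta E.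
Proof.
apply: le_ereal_inf_tmp => _ [D [a [l [_ _ ->]]]].
by apply: esum_ge0 => k _; rewrite lee_fin powR_ge0.
Qed.

Lemma le_hcontent delta E F : E `<=` F -> hcontent delta E <= hcontent delta F.
Proof.
move=> EF; apply: ereal_inf_le_tmp => _ [D [a [l [l0 cov ->]]]].
by exists D, a, l; split=> //; exact: subset_trans cov.
Qed.

(** The definition indexes coverings by subsets of [nat]; [choice.pickle] transports any countable
    index type there, so later coverings can be indexed by pairs or by dyadic cubes. *)
Lemma hcontent_le_esum delta (T : countType) (D : set T) (a : T -> 'rV[R]_n)
    (l : T -> R) E :
  (forall t, D t -> 0 < l t)%R -> E `<=` \bigcup_(t in D) cube (a t) (l t) ->
  hcontent delta E <= \esum_(t in D) (l t `^ delta)%:E.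
Proof.
move=> l0 cov; apply: ereal_inf_lbound.
pose b k := if choice.unpickle k is Some t then a t else 0%R.
pose r k := if choice.unpickle k is Some t then l t else 0%R.
exists (choice.pickle @` D), b, r; split.
- by move=> _ [t Dt <-]; rewrite /r choice.pickleK l0.
- move=> x /cov[t Dt xt]; exists (choice.pickle t); first by exists t.
  by rewrite /b /r choice.pickleK.
- rewrite esum_image; last by move=> i j _ _; apply: (pcan_inj choice.pickleK).
  by apply: eq_esum => t _; rewrite /r choice.pickleK.
Qed.

Lemma hcontent_cube_le delta a l : (0 < l)%R ->
  hcontent delta (@cube R n a l) <= (l `^ delta)%:E.
Proof.
move=> l0; have := @hcontent_le_esum delta unit setT (fun=> a) (fun=> l).
rewrite esum_fin_cst ?card_unit ?mul1r ?powR_ge0//; apply => //.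
by move=> x xQ; exists tt.
Qed.

Lemma hcontent_cover delta E (c : \bar R) : hcontent delta E < c ->
  exists (D : set nat) (a : nat -> 'rV[R]_n) (l : nat -> R),
    [/\ forall k, D k -> (0 < l k)%R,
        E `<=` \bigcup_(k in D) cube (a k) (l k) &
        \esum_(k in D) (l k `^ delta)%:E < c].
Proof.
by move=> /ereal_inf_lt[_ [D [a [l [l0 cov ->]]]] lt]; exists D, a, l; split.
Qed.

Lemma hcontent_bigcup delta (T : countType) (I : set T) (F : T -> set 'rV[R]_n) :
  hcontent delta (\bigcup_(i in I) F i) <= \esum_(i in I) hcontent delta (F i).
Proof.
(* A piece of infinite content is treated apart: choosing a near-optimal covering needs a strict
   inequality after adding a positive number, which fails at [+oo]. *)
have [[i [Ii Fi]]|fin] := pselect (exists i, I i /\ hcontent delta (F i) = +oo).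
  suff -> : \esum_(i in I) hcontent delta (F i) = +oo by rewrite leey.
  apply/eqP; rewrite -leye_eq -Fi.
  exact: (@esum_ge_term _ _ _ (fun i => hcontent delta (F i)) _ Ii
    (hcontent_ge0 _ _)).
apply/lee_addgt0Pr => e e0.
have H (i : T) : exists p : set nat * (nat -> 'rV[R]_n) * (nat -> R), I i ->
    [/\ forall k, p.1.1 k -> (0 < p.2 k)%R,
        F i `<=` \bigcup_(k in p.1.1) cube (p.1.2 k) (p.2 k) &
        \esum_(k in p.1.1) (p.2 k `^ delta)%:E <
          hcontent delta (F i) + (e / (2 ^ (choice.pickle i).+1)%:R)%:E].
  have [Ii|nIi] := pselect (I i); last by exists (set0, fun=> 0%R, fun=> 0%R).
  have [|D [a [l H]]] := @hcontent_cover delta (F i)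
      (hcontent delta (F i) + (e / (2 ^ (choice.pickle i).+1)%:R)%:E).
    rewrite lteDl ?lte_fin ?divr_gt0 ?ltr0n ?expn_gt0//.
    rewrite ge0_fin_numE ?hcontent_ge0// ltey; apply/eqP => Foo.
    by apply: fin; exists i.
  by exists (D, a, l).
move/choice : H => [p Hp].
apply: (@le_trans _ _ (\esum_(k in I `*`` (fun i => (p i).1.1))
    ((p k.1).2 k.2 `^ delta)%:E)).
  apply: (@hcontent_le_esum delta _ _ (fun k => (p k.1).1.2 k.2)
    (fun k => (p k.1).2 k.2)).
    by move=> [i k] /= [Ii ik]; have [+ _ _] := Hp i Ii; apply.
  move=> x [i Ii Fx]; have [_ + _] := Hp i Ii => /(_ x Fx)[k ik xk].
  by exists (i, k).
rewrite -(esum_esum (a := fun i k => ((p i).2 k `^ delta)%:E)); last first.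
  by move=> *; rewrite lee_fin powR_ge0.
apply: (@le_trans _ _ (\esum_(i in I) (hcontent delta (F i) +
     (e / (2 ^ (choice.pickle i).+1)%:R)%:E))).
  by apply: le_esum => i Ii; have [_ _ /ltW] := Hp i Ii.
rewrite esumD; last 2 first.
- by move=> *; exact: hcontent_ge0.
- by move=> *; rewrite lee_fin divr_ge0// ltW.
by apply: leeD => //; apply: esum_geometric; exact: ltW.
Qed.

Lemma hcontent_setU delta E F :
  hcontent delta (E `|` F) <= hcontent delta E + hcontent delta F.
Proof.
have -> : E `|` F = \bigcup_(b in [set: bool]) (if b then E else F).
  by apply/seteqP; split=> [x [Ex|Fx]|x [[] _ ?]]; [exists true|exists false|
    left|right].
apply: (le_trans (hcontent_bigcup _ _ _)).
rewrite esum_finType; last by move=> b; exact: hcontent_ge0.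
by rewrite big_bool/=.
Qed.

Lemma hcontent0_bigcup delta (T : countType) (I : set T) (F : T -> set 'rV[R]_n) :
  (forall i, I i -> hcontent delta (F i) = 0) ->
  hcontent delta (\bigcup_(i in I) F i) = 0.
Proof.
move=> F0; apply/eqP; rewrite eq_le hcontent_ge0 andbT.
by apply: (le_trans (hcontent_bigcup _ _ _)); rewrite esum1.
Qed.

Lemma hcontent0_subset delta E F :
  E `<=` F -> hcontent delta F = 0 -> hcontent delta E = 0.
Proof.
move=> EF F0; apply/eqP; rewrite eq_le hcontent_ge0 andbT -F0.
exact: le_hcontent.
Qed.

Lemma hcontent_null_setU delta E F N : E `<=` F `|` N ->
  hcontent delta N = 0 -> hcontent delta E <= hcontent delta F.
Proof.
move=> EFN N0; apply: (le_trans (le_hcontent _ EFN)).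
by apply: (le_trans (hcontent_setU _ _ _)); rewrite N0 adde0.
Qed.

End content.

(** * Exact content of a cube, by comparison with volume *)

Section volume.
Context {R : realType}.

(* Slicing along the last coordinate: the slice of the covering at height t covers
   a cube of one dimension less, and integrating in t gives the volume bound. *)
Lemma expn_le_cover (m : nat) : forall (D : set nat) (a : nat -> nat -> R)
    (l : nat -> R) (b : nat -> R) (L : R),
  (forall i, D i -> 0 < l i) -> 0 < L ->
  (forall x : nat -> R, (forall j, (j < m)%N -> b j < x j <= b j + L) ->
    exists i, D i /\ forall j, (j < m)%N -> a i j < x j <= a i j + l i) ->
  ((L ^+ m)%:E <= \esum_(i in D) (l i ^+ m)%:E)%E.
Proof.
elim: m => [|m IH] D a l b L l0 L0 cov.
  (* In dimension 0 the cube is a point: some member of the covering exists, and it contributes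
     [l i ^+ 0 = 1]. *)
  have [//|i [Di _]] := cov b.
  by rewrite expr0; apply: (@esum_ge_term _ _ _ (fun i => (l i ^+ 0)%:E) _ Di).
pose c i := if i \in D then l i ^+ m else 0.
have c0 i : 0 <= c i.
  by rewrite /c; case: ifPn => // /set_mem/l0/ltW ?; rewrite exprn_ge0.
pose J i : set R := `]a i m, a i m + l i]%classic.
pose K : set R := `]b m, b m + L]%classic.
pose f i (t : R) : \bar R := (c i * \1_(J i) t)%:E.
have f0 i t : (0 <= f i t)%E by rewrite lee_fin mulr_ge0.
have mf i : measurable_fun K (f i).
  apply/measurable_EFinP; apply: measurable_funM; first exact: measurable_cst.
  by apply: measurable_indic; exact: measurable_itv.
have slice t : K t -> ((L ^+ m)%:E <= \sum_(i <oo) f i t)%E.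
  rewrite /K /= in_itv/= => tK.
  have := IH [set i | D i /\ J i t] a l b L.
  rewrite nneseries_esumT// => H; apply: (le_trans (H _ _ _)) => //.
  - by move=> i [/l0].
  - move=> x xb; have [|i [Di xi]] := cov (fun j => if j == m then t else x j).
      move=> j; rewrite ltnS leq_eqVlt; case: eqP => [->//|_ /= jm].
      exact: xb.
    exists i; split.
      split=> //; have := xi m (ltnSn m); rewrite eqxx.
      by rewrite /J /= in_itv.
    by move=> j jm; have := xi j (ltnW jm); rewrite ltn_eqF.
  - rewrite esum_mkcond; apply: le_esum => i _; case: ifPn => [|_].
      rewrite inE /= => -[Di Jit].
      by rewrite /f /c mem_set// indicE mem_set// mulr1.
    exact: f0.
have mK : measurable K by exact: measurable_itv.
have -> : ((L ^+ m.+1)%:E =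
    \int[@lebesgue_measure R]_(t in K) (cst (L ^+ m)%:E) t)%E.
  rewrite integral_cst// /K/= lebesgue_measure_itv/= lte_fin ltrDl L0.
  by rewrite -EFinB -EFinM exprSr; congr (_ * _)%:E; ring.
apply: (@le_trans _ _
    (\int[@lebesgue_measure R]_(t in K) (\sum_(i <oo) f i t))%E).
  apply: ge0_le_integral => //.
  - by move=> t _; rewrite lee_fin exprn_ge0 ?ltW.
  - exact: (@ge0_emeasurable_sum _ _ _ K f xpredT).
rewrite integral_nneseries// nneseries_esumT; last first.
  by move=> i; apply: integral_ge0 => *.
rewrite [leRHS]esum_mkcond; apply: le_esum => i _.
rewrite /f; under eq_integral do rewrite EFinM.
rewrite ge0_integralZl_EFin//; last first.
  by apply/measurable_EFinP; apply: measurable_indic; exact: measurable_itv.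
rewrite integral_indic//; last exact: measurable_itv.
rewrite /c; case: ifPn => [/set_mem Di|]; last by rewrite mul0e.
rewrite exprSr EFinM; apply: lee_wpmul2l.
  by rewrite lee_fin exprn_ge0// ltW// l0.
apply: (@le_trans _ _ (@lebesgue_measure R (J i))).
  apply: le_measure; rewrite ?inE; [|exact: measurable_itv|exact: subIsetl].
  by apply: measurableI; exact: measurable_itv.
rewrite /J lebesgue_measure_itv/= lte_fin ltrDl l0//.
by rewrite -EFinB lee_fin le_eqVlt; apply/orP; left; apply/eqP; ring.
Qed.

End volume.

Section content_cube.
Local Open Scope ereal_scope.
Context {R : realType} {n : nat}.
Implicit Types (a : 'rV[R]_n) (l delta : R).

Lemma hcontent_cube delta a l : (0 < delta)%R -> (delta <= n%:R)%R ->
  (0 < l)%R -> hcontent delta (cube a l) = (l `^ delta)%:E.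
Proof.
move=> d0 dn l0; apply/eqP; rewrite eq_le hcontent_cube_le//=.
apply: le_ereal_inf_tmp => _ [D [b [r [r0 cov ->]]]].
have pow_ge0 i : 0 <= (r i `^ delta)%:E by rewrite lee_fin powR_ge0.
(* A covering cube of side at least [l] suffices by itself. Otherwise every side [r] is at most [l],
   and [delta <= n] gives [r^delta >= (l^delta / l^n) r^n], which reduces the claim to the volume
   bound. *)
have [[i [Di lri]]|small] := pselect (exists i, D i /\ (l <= r i)%R).
  apply: (@le_trans _ _ (r i `^ delta)%:E).
    by rewrite lee_fin ge0_ler_powR ?nnegrE// ltW// r0.
  exact: (@esum_ge_term _ _ _ (fun i => (r i `^ delta)%:E) _ Di).
pose co (p : 'rV[R]_n) (j : nat) : R :=
  if insub j is Some k then p ord0 k else 0%R.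
have coE p (k : 'I_n) : co p k = p ord0 k by rewrite /co valK.
have vol : (l ^+ n)%:E <= \esum_(i in D) (r i ^+ n)%:E.
  apply: (@expn_le_cover R n D (fun i => co (b i)) r (co a) l r0 l0).
  move=> x xa; have [|i Di xi] := cov (\row_j x j)%R.
    by move=> j /=; rewrite mxE -coE; apply: xa.
  exists i; split => // j jn; have := xi (Ordinal jn).
  by rewrite mxE -coE.
have lp : (0 < l `^ delta / l ^+ n)%R by rewrite divr_gt0 ?powR_gt0 ?exprn_gt0.
(* The absolute value keeps the terms nonnegative outside [D], where nothing is known about [r]. *)
apply: (@le_trans _ _
    (\esum_(i in D) ((l `^ delta / l ^+ n)%:E * (`|r i| ^+ n)%:E))).
  rewrite esumZl//.
  apply: (@le_trans _ _ ((l `^ delta / l ^+ n)%:E * (l ^+ n)%:E)).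
    by rewrite -EFinM lee_fin divfK// expf_neq0// gt_eqF.
  apply: lee_wpmul2l; first by rewrite lee_fin ltW.
  apply: (le_trans vol).
  by apply: le_esum => i Di; rewrite lee_fin ger0_norm// ltW// r0.
apply: le_esum => i Di; have ri := r0 _ Di.
have {small} ril : (r i <= l)%R.
  by rewrite leNgt; apply/negP => lri; apply: small; exists i; split => //; exact: ltW.
rewrite -EFinM lee_fin (ger0_norm (ltW ri)) mulrAC ler_pdivrMr ?exprn_gt0//.
rewrite -(powR_mulrn _ (ltW ri)) -(powR_mulrn _ (ltW l0)).
have [e e0 ->] : exists2 e, (0 <= e)%R & n%:R = (delta + e)%R.
  by exists (n%:R - delta)%R; rewrite ?subr_ge0// addrC subrK.
rewrite !powRD ?(gt_eqF ri) ?(gt_eqF l0) ?implybT//.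
rewrite mulrCA; do 2 (rewrite ler_pM2l ?powR_gt0//).
by rewrite ge0_ler_powR ?nnegrE// ltW.
Qed.

End content_cube.

Lemma nonincreasing_emeasurable {R : realType} (D : set R) (h : R -> \bar R) :
  measurable D -> {homo h : x y / x <= y >-> (y <= x)%E} -> measurable_fun D h.
Proof.
move=> mD hmono; apply: (measurability _ (ErealGenOInfty.measurableE R)) => //.
move=> /= _ [_ [r ->]] <-; apply: measurableI => //.
apply: is_interval_measurable => s t /=.
rewrite !in_itv/= !andbT => fs ft u /andP[su ut].
by rewrite in_itv/= andbT (lt_le_trans ft)// hmono.
Qed.

(** * Choquet integrals compared with sums over levels *)

Section choquet.
Local Open Scope ereal_scope.
Context {R : realType} {n : nat}.
Context (delta : R).
Implicit Types (E F : set 'rV[R]_n) (f g : 'rV[R]_n -> \bar R).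

Definition suplevel E f (t : R) := hcontent delta [set x | E x /\ t%:E < f x].

Lemma suplevel_ge0 E f t : 0 <= suplevel E f t.
Proof. exact: hcontent_ge0. Qed.

Lemma suplevel_le E f t : suplevel E f t <= hcontent delta E.
Proof. by apply: le_hcontent => x []. Qed.

Lemma suplevel_noninc E f :
  {homo suplevel E f : x y / (x <= y)%R >-> (y <= x)}.
Proof.
move=> s t st; apply: le_hcontent => x [Ex tf]; split => //.
by apply: le_lt_trans tf; rewrite lee_fin.
Qed.

Let mitv : measurable (`[0%R, +oo[%classic : set R).
Proof. exact: measurable_itv. Qed.

Lemma le_choquet E F f g :
  (forall t, (0 <= t)%R -> suplevel E f t <= suplevel F g t) ->
  choquet delta E f <= choquet delta F g.
Proof.
move=> H; apply: ge0_le_integral => //.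
- by move=> t _; exact: hcontent_ge0.
- exact: nonincreasing_emeasurable (suplevel_noninc E f).
- exact: nonincreasing_emeasurable (suplevel_noninc F g).
- by move=> t /=; rewrite in_itv/= andbT; exact: H.
Qed.

Lemma choquet_ge0 E f : 0 <= choquet delta E f.
Proof. by apply: integral_ge0 => t _; exact: hcontent_ge0. Qed.

Section layers.
Context (t : nat -> R) (t0 : t 0%N = 0%R) (tnd : forall k, (t k <= t k.+1)%R)
  (tub : forall x, exists k, (x < t k)%R).

Let step (c : nat -> \bar R) (x : R) : \bar R :=
  \sum_(k <oo) (c k * (\1_(`[t k, t k.+1[%classic : set R) x)%:E).

Let tmono j k : (j <= k)%N -> (t j <= t k)%R.
Proof. by apply: (@homo_leq _ _ <=%R) => //; exact: le_trans. Qed.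

Let term_ge0 (c : nat -> \bar R) k x : (forall k, 0 <= c k) ->
  0 <= c k * (\1_(`[t k, t k.+1[%classic : set R) x)%:E.
Proof. by move=> c0; rewrite mule_ge0// lee_fin. Qed.

Let step_eq (c : nat -> \bar R) x : (forall k, 0 <= c k) -> (0 <= x)%R ->
  exists k, (t k <= x < t k.+1)%R /\ step c x = c k.
Proof.
move=> c0 x0.
have [[|k] xk kmin] := ex_minnP (tub x); first by move: xk; rewrite t0 ltNge x0.
have tkx : (t k <= x)%R.
  by rewrite leNgt; apply/negP => /kmin; rewrite ltnn.
exists k; split; first by rewrite tkx xk.
rewrite /step nneseries_esumT; last by move=> j; exact: term_ge0.
transitivity (\esum_(i in [set k]) c i); last by rewrite esum_set1.
rewrite [RHS]esum_mkcond; apply: eq_esum => j _.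
rewrite indicE; case: ifPn => [|jk].
  by rewrite inE /= => ->; rewrite mem_set ?mule1//= in_itv/= tkx.
rewrite memNset ?mule0//= in_itv/= => /andP[tjx xtj].
move/negP : jk; apply; rewrite inE /=; apply/eqP; rewrite eqn_leq.
apply/andP; split; rewrite leqNgt; apply/negP => lt.
  by have := lt_le_trans xk (tmono lt); rewrite ltNge tjx.
by have := lt_le_trans xtj (tmono lt); rewrite ltNge tkx.
Qed.

Let mterm (c : nat -> \bar R) k : measurable_fun (`[0%R, +oo[%classic : set R)
  (fun x => c k * (\1_(`[t k, t k.+1[%classic : set R) x)%:E).
Proof.
apply: measurable_funeM; apply/measurable_EFinP; apply: measurable_indic.
exact: measurable_itv.
Qed.

Let mstep (c : nat -> \bar R) : (forall k, 0 <= c k) ->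
  measurable_fun (`[0%R, +oo[%classic : set R) (step c).
Proof.
move=> c0; apply: (@ge0_emeasurable_sum _ _ _ _
  (fun k x => c k * (\1_(`[t k, t k.+1[%classic : set R) x)%:E) xpredT).
  by move=> k x _ _; exact: term_ge0.
by move=> k _; exact: mterm.
Qed.

Let int_step (c : nat -> \bar R) : (forall k, 0 <= c k) ->
  \int[@lebesgue_measure R]_(x in `[0%R, +oo[) step c x =
  \sum_(k <oo) ((t k.+1 - t k)%:E * c k).
Proof.
move=> c0; rewrite integral_nneseries//; last 2 first.
- by move=> k; exact: mterm.
- by move=> k x _; exact: term_ge0.
apply: eq_eseriesr => k _.
have mi : measurable_fun (`[0%R, +oo[%classic : set R)
    (fun x => (\1_(`[t k, t k.+1[%classic : set R) x)%:E : \bar R).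
  apply/measurable_EFinP; apply: measurable_indic.
  exact: measurable_itv.
rewrite ge0_integralZl// integral_indic//.
rewrite setIidl; last first.
  move=> x /=; rewrite !in_itv/= andbT => /andP[tx _].
  by rewrite (le_trans _ tx)// -t0 tmono.
rewrite /= lebesgue_measure_itv/= lte_fin muleC; case: ltP => [_|le].
  by rewrite -EFinB.
have -> : t k.+1 = t k by apply/le_anti; rewrite le tnd.
by rewrite subrr.
Qed.

(** The integrand is nonincreasing, so on each interval it is at most its value at the left end;
    right ends give the reverse bound in [layers_le_choquet]. *)
Lemma choquet_le_layers E f :
  choquet delta E f <=
  \sum_(k <oo) ((t k.+1 - t k)%:E * suplevel E f (t k)).
Proof.
pose c k := suplevel E f (t k).
have c0 k : 0 <= c k by exact: suplevel_ge0.
rewrite -int_step//; apply: ge0_le_integral => //.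
- by move=> x _; exact: hcontent_ge0.
- exact: nonincreasing_emeasurable (suplevel_noninc E f).
- exact: mstep.
- move=> x /=; rewrite in_itv/= andbT => x0.
  have [k [/andP[tkx _] ->]] := step_eq c0 x0.
  exact: suplevel_noninc.
Qed.

Lemma layers_le_choquet E f :
  \sum_(k <oo) ((t k.+1 - t k)%:E * suplevel E f (t k.+1)) <=
  choquet delta E f.
Proof.
pose c k := suplevel E f (t k.+1).
have c0 k : 0 <= c k by exact: suplevel_ge0.
rewrite -(int_step c0); apply: ge0_le_integral => //.
- by move=> x; rewrite /= in_itv/= andbT => /(step_eq c0)[k [_ ->]].
- exact: mstep.
- exact: nonincreasing_emeasurable (suplevel_noninc E f).
- move=> x /=; rewrite in_itv/= andbT => x0.
  have [k [/andP[_ xtk] ->]] := step_eq c0 x0.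
  by apply: suplevel_noninc; exact: ltW.
Qed.

End layers.

Lemma arith_layers (s : R) : (0 < s)%R ->
  forall x, exists k : nat, (x < s *+ k)%R.
Proof.
move=> s0 x; exists (Num.bound (`|x| / s)).
rewrite -mulr_natl -ltr_pdivrMr//.
apply: le_lt_trans (archi_boundP _); last by rewrite divr_ge0// ltW.
by rewrite ler_pM2r ?invr_gt0// ler_norm.
Qed.

(** The first term of the right-endpoint sum over the levels [0, s, 2s, ...] is already the
    left-hand side. *)
Lemma chebyshev E f (s : R) : (0 < s)%R ->
  s%:E * suplevel E f s <= choquet delta E f.
Proof.
move=> s0; apply: le_trans (@layers_le_choquet (fun k => s *+ k)%R _ _ _ E f).
- rewrite nneseries_esumT; last first.
    by move=> k; rewrite mule_ge0// ?suplevel_ge0// lee_fin mulrS addrK ltW.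
  apply: le_trans (@esum_ge_term _ _ _ (fun k : nat => _) 0%N I _).
    by rewrite mulr1n mulr0n subr0.
  by rewrite mule_ge0// ?suplevel_ge0// mulr1n mulr0n subr0 lee_fin ltW.
- by rewrite mulr0n.
- by move=> k; rewrite mulrS lerDr ltW.
- exact: arith_layers.
Qed.

Lemma choquet_exp_le E f (s A : R) : (0 < s)%R -> (0 <= A)%R ->
  (forall k, suplevel E f (s *+ k) <= (A / 2 ^+ k)%:E) ->
  choquet delta E f <= (2 * s * A)%:E.
Proof.
move=> s0 A0 H.
apply: (le_trans (@choquet_le_layers (fun k => s *+ k)%R _ _ _ E f)).
- by rewrite mulr0n.
- by move=> k; rewrite mulrS lerDr ltW.
- exact: arith_layers.
apply: (@le_trans _ _ (\sum_(k <oo) ((2 * s * A) / (2 ^ k.+1)%:R)%:E)).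
  apply: lee_nneseries => [k _|k _].
    by rewrite mule_ge0// ?suplevel_ge0// lee_fin mulrS addrK ltW.
  rewrite mulrS addrK; apply: (le_trans (lee_wpmul2l _ (H k))).
    by rewrite lee_fin ltW.
  rewrite -EFinM lee_fin natrX exprS invfM le_eqVlt; apply/orP; left.
  by apply/eqP; field; rewrite expf_neq0.
by apply: epsilon_trick0; rewrite !mulr_ge0// ltW.
Qed.

End choquet.

(** * Geometric levels *)

Section choquet_dyadic.
Local Open Scope ereal_scope.
Context {R : realType} {n : nat} (delta : R).
Implicit Types (E : set 'rV[R]_n) (f : 'rV[R]_n -> \bar R) (s : R).

(** Level 0 precedes [s, 2s, 4s, ...] because the layer sums start at 0; hence the shift by one. The
    gap above [s 2^j] is again [s 2^j]. *)
Let lev s k : R := if k is j.+1 then (s * 2 ^+ j)%R else 0%R.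

Let lev_nd s : (0 < s)%R -> forall k, (lev s k <= lev s k.+1)%R.
Proof.
move=> s0 [|k] /=; first by rewrite expr0 mulr1 ltW.
by rewrite ler_pM2l// ler_eXn2l ?ltr1n.
Qed.

Let lev_ub s : (0 < s)%R -> forall x, exists k, (x < lev s k)%R.
Proof.
move=> s0 x; have [k xk] := arith_layers s0 x; exists k.+1.
apply: (lt_le_trans xk); rewrite -mulr_natr ler_pM2l// -natrX ler_nat.
exact: ltnW (ltn_expl _ _).
Qed.

Lemma choquet_dyadic_le E f s : (0 < s)%R ->
  choquet delta E f <= s%:E * suplevel delta E f 0 +
    \esum_(k in [set: nat]) ((s * 2 ^+ k)%:E * suplevel delta E f (s * 2 ^+ k)).
Proof.
move=> s0.
apply: (le_trans (choquet_le_layers _ erefl (lev_nd s0) (lev_ub s0) E f)).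
have d0 k : 0 <= (lev s k.+1 - lev s k)%:E * suplevel delta E f (lev s k).
  by rewrite mule_ge0 ?suplevel_ge0// lee_fin subr_ge0 lev_nd.
rewrite nneseries_recl// -(nneseries_addn (f := fun k =>
  (lev s k.+1 - lev s k)%:E * suplevel delta E f (lev s k)) 1%N)//.
rewrite /= expr0 mulr1 subr0 leeD2l//.
rewrite nneseries_esumT; last by move=> k; exact: d0.
apply: le_esum => k _; rewrite addn1/=; apply: lee_wpmul2r.
  exact: suplevel_ge0.
by rewrite lee_fin exprS lerBlDr; have := exprn_gt0 k (ltr0Sn R 1); nra.
Qed.

(** The factor 2 arises because, for [k > 0], the gap below [s 2^k] is only half of [s 2^k]. *)
Lemma dyadic_le_choquet E f s : (0 < s)%R ->
  \esum_(k in [set: nat]) ((s * 2 ^+ k)%:E * suplevel delta E f (s * 2 ^+ k))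
    <= 2%:E * choquet delta E f.
Proof.
move=> s0.
have := layers_le_choquet delta erefl (lev_nd s0) (lev_ub s0) E f.
move=> /(@lee_wpmul2l _ 2%:E); rewrite lee_fin => /(_ (ler0n _ 2)).
apply: le_trans; rewrite nneseries_esumT; last first.
  by move=> k; rewrite mule_ge0 ?suplevel_ge0// lee_fin subr_ge0 lev_nd.
rewrite -esumZl//; last first.
  by move=> k; rewrite mule_ge0 ?suplevel_ge0// lee_fin subr_ge0 lev_nd.
apply: le_esum => -[_|k _].
  rewrite /= expr0 mulr1 subr0 muleA -EFinM; apply: lee_wpmul2r.
    exact: suplevel_ge0.
  by rewrite lee_fin; lra.
rewrite muleA -EFinM /=; apply: lee_wpmul2r; first exact: suplevel_ge0.
by rewrite lee_fin le_eqVlt exprS; apply/orP; left; apply/eqP; ring.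
Qed.

(** The decay [4^-k] beats the layer widths [s 2^k]. Of the constant 3, one unit comes from the
    values below [s], two from the geometric series. *)
Lemma choquet_pow_le E f (s A : R) : (0 < s)%R -> (0 <= A)%R ->
  suplevel delta E f 0 <= A%:E ->
  (forall k, suplevel delta E f (s * 2 ^+ k) <= (A / 4 ^+ k)%:E) ->
  choquet delta E f <= (3 * s * A)%:E.
Proof.
move=> s0 A0 H0 H; apply: (le_trans (choquet_dyadic_le _ _ s0)).
have -> : (3 * s * A)%:E = s%:E * A%:E + (2 * s * A)%:E.
  by rewrite -EFinM -EFinD; congr _%:E; ring.
apply: leeD; first by rewrite lee_wpmul2l// lee_fin ltW.
apply: (@le_trans _ _ (\esum_(k in [set: nat])
    ((2 * s * A) / (2 ^ k.+1)%:R)%:E)); last first.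
  rewrite -nneseries_esumT ?epsilon_trick0//.
    by rewrite !mulr_ge0// ltW.
  by move=> k; rewrite lee_fin divr_ge0// !mulr_ge0// ltW.
apply: le_esum => k _; apply: (le_trans (lee_wpmul2l _ (H k))).
  by rewrite lee_fin mulr_ge0 ?exprn_ge0// ltW.
rewrite -EFinM lee_fin natrX exprS.
have -> : (4 = 2 * 2 :> R)%R by ring.
rewrite exprMn le_eqVlt; apply/orP; left; apply/eqP; field.
by rewrite expf_neq0.
Qed.

End choquet_dyadic.

(** * Dyadic grids rooted at a cube *)

Section dyadic.
Context {R : realType} {n : nat}.
Implicit Types (a x : 'rV[R]_n) (L : R).

(* The dyadic grid of root (a, L): a pair (k, z) stands for the cube of side L / 2^k
   with lower corner a + (L / 2^k) z. Only levels k >= 0 occur. *)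
Definition dyadic : Type := (nat * 'rV[int]_n)%type.
Implicit Types (p q : dyadic).

HB.instance Definition _ := Countable.on dyadic.

Definition dside L p : R := L / 2 ^+ p.1.

Definition dcube a L p : set 'rV[R]_n :=
  cube (a + dside L p *: map_mx intr p.2) (dside L p).

(** Floor division, also right for negative corners, gives the corner in the coarser grid. For
    [j > p.1] the truncated subtraction gives no geometric ancestor, which is why [below] also asks
    for [q.1 <= p.1]. *)
Definition ancestor p j : dyadic :=
  (j, map_mx (fun t : int => (t %/ (2 ^ (p.1 - j))%N)%Z) p.2).

Definition below p q := (q.1 <= p.1)%N /\ q = ancestor p q.1.

Lemma dside_gt0 L p : 0 < L -> 0 < dside L p.
Proof. by move=> L0; rewrite divr_gt0// exprn_gt0. Qed.

Lemma dcubeP a L p x : 0 < L -> dcube a L p x <->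
  forall i, (p.2 0 i)%:~R < (x 0 i - a 0 i) / dside L p <= (p.2 0 i)%:~R + 1.
Proof.
move=> L0; have s0 := dside_gt0 p L0; rewrite /dcube /cube/=.
split=> H i; have := H i; rewrite !mxE.
  rewrite ltr_pdivlMr// ler_pdivrMr// => /andP[lo hi].
  by apply/andP; split; nra.
rewrite ltr_pdivlMr// ler_pdivrMr// => /andP[lo hi].
by apply/andP; split; nra.
Qed.

Lemma dcube_inj a L p q x : 0 < L -> p.1 = q.1 -> dcube a L p x -> dcube a L q x ->
  p = q.
Proof.
case: p q => [k z] [_ y] L0 /= <- /(dcubeP _ _ _ L0) zx /(dcubeP _ _ _ L0) yx.
congr (_, _); apply/rowP => i.
have /= /andP[z1 z2] := zx i; have /= /andP[y1 y2] := yx i.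
apply/le_anti; rewrite -!ltzD1 -!(ltr_int R) !intrD.
by rewrite (lt_le_trans z1 y2) (lt_le_trans y1 z2).
Qed.

Lemma dcube_ancestor a L p j : 0 < L -> (j <= p.1)%N ->
  dcube a L p `<=` dcube a L (ancestor p j).
Proof.
move=> L0 jk x /(dcubeP _ _ _ L0) px; apply/dcubeP => // i.
have /andP[p1 p2] := px i; rewrite !mxE /=.
set t := p.2 0 i in p1 p2 *; set N := (2 ^ (p.1 - j))%N.
have N0 : (0 < N)%N by rewrite expn_gt0.
have N0R : 0 < N%:R :> R by rewrite ltr0n.
have sE : dside L (ancestor p j) = dside L p * N%:R.
  have -> : dside L p = L / (2 ^+ (p.1 - j) * 2 ^+ j) by rewrite -exprD subnK.
  by rewrite /dside /N natrX /=; field; rewrite !expf_neq0.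
have s0 := dside_gt0 p L0.
have tE : (t%:~R : R) = (t %/ N)%Z%:~R * N%:R + (t %% N)%Z%:~R.
  by rewrite {1}(divz_eq t N) intrD intrM.
have r0 : (0 <= ((t %% N)%Z%:~R : R)) by rewrite ler0z modz_ge0// gt_eqF.
have r1 : (((t %% N)%Z%:~R : R) + 1 <= N%:R).
  have : (t %% N)%Z + 1 <= N :> int by rewrite lezD1 ltz_pmod.
  by rewrite -(ler_int R) intrD.
rewrite sE invfM mulrA ltr_pdivlMr// ler_pdivrMr//.
apply/andP; split; nra.
Qed.

Lemma dcube_root a L : dcube a L (0%N, 0) = cube a L.
Proof.
rewrite /dcube /dside expr0 divr1 /=; congr cube.
by apply/rowP => i; rewrite !mxE mulr0 addr0.
Qed.

Lemma ancestorE a L p q x : 0 < L -> (q.1 <= p.1)%N ->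
  dcube a L p x -> dcube a L q x -> q = ancestor p q.1.
Proof.
by move=> L0 qp px qx; apply: (dcube_inj L0 _ qx) => //; exact: dcube_ancestor px.
Qed.

Lemma dcube_neq0 L p : 0 < L -> dcube 0 L p !=set0.
Proof.
move=> L0; exists (\row_i (((p.2 0 i)%:~R + 1) * dside L p)).
apply/dcubeP => // i; rewrite !mxE subr0 mulfK ?gt_eqF ?dside_gt0//.
by rewrite ltrDl ltr01 lexx.
Qed.

(** Proved geometrically rather than by division identities: a point of the cube of [p] lies in both
    candidates, and two cubes of one level with a common point coincide. *)
Lemma ancestor_ancestor p i j : (j <= i <= p.1)%N ->
  ancestor (ancestor p i) j = ancestor p j.
Proof.
move=> /andP[ji ip]; have [x px] := dcube_neq0 p (@ltr01 R).
have jp := leq_trans ji ip.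
apply/esym/(@ancestorE 0 1 (ancestor p i) (ancestor p j) x) => //.
  exact: dcube_ancestor px.
exact: dcube_ancestor px.
Qed.

Lemma ancestor_self p : ancestor p p.1 = p.
Proof.
have [x px] := dcube_neq0 p (@ltr01 R).
apply/esym/(@ancestorE 0 1 p p x) => //.
Qed.

Lemma belowxx p : below p p.
Proof. by split => //; rewrite ancestor_self. Qed.

Lemma dyadic_level (l L : R) : 0 < l <= L ->
  exists k, l <= L / 2 ^+ k < 2 * l.
Proof.
move=> /andP[l0 lL]; have [m Lm] := arith_layers l0 L.
have ex : exists k, L / 2 ^+ k < 2 * l.
  exists m; rewrite ltr_pdivrMr ?exprn_gt0//; apply: (lt_le_trans Lm).
  rewrite -[l *+ m]mulr_natr (mulrC 2 l) -mulrA ler_pM2l// -natrX -natrM ler_nat.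
  by rewrite (leq_trans (ltnW (ltn_expl _ (ltnSn 1))))// leq_pmull.
have [k kl kmin] := ex_minnP ex; exists k; rewrite kl andbT.
case: k kl kmin => [|k] kl kmin; first by rewrite expr0 divr1.
have : 2 * l <= L / 2 ^+ k by rewrite leNgt; apply/negP => /kmin; rewrite ltnn.
rewrite exprS invfM mulrCA => h; lra.
Qed.

(** In units of the grid step, a left-open interval of length at most 1 starting in [[m, m + 1[]
    lies in []m, m + 2]]; in each coordinate [e] selects one of the two halves, which gives [2^n]
    cubes. *)
Definition neighbor a L (b : 'rV[R]_n) k (e : {ffun 'I_n -> bool}) : dyadic :=
  (k, \row_i (Num.floor ((b 0 i - a 0 i) / (L / 2 ^+ k)) + (e i : nat)%:Z)).

Lemma cube_neighbors a L (b : 'rV[R]_n) (l : R) k : 0 < L -> l <= L / 2 ^+ k ->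
  cube b l `<=` \bigcup_(e in [set: {ffun 'I_n -> bool}])
                   dcube a L (neighbor a L b k e).
Proof.
move=> L0 ls x xb; set s := L / 2 ^+ k in ls *.
have s0 : 0 < s by rewrite divr_gt0// exprn_gt0.
pose m i : int := Num.floor ((b 0 i - a 0 i) / s).
exists [ffun i => (m i)%:~R + 1 < (x 0 i - a 0 i) / s] => //.
apply/dcubeP => // i; rewrite !mxE ffunE/= -/s -/(m i) intrD.
have /andP[] := Num.Theory.floor_itv ((b 0 i - a 0 i) / s); rewrite -/(m i) intrD.
have /andP[bx xb'] := xb i.
rewrite /dside /= -/s; set v := (x 0 i - a 0 i) / s.
have uv : (b 0 i - a 0 i) / s < v by rewrite ltr_pM2r ?invr_gt0// ltrD2r.
have vu : v <= (b 0 i - a 0 i) / s + 1.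
  have -> : (b 0 i - a 0 i) / s + 1 = (b 0 i - a 0 i + s) / s.
    by field; rewrite gt_eqF.
  by rewrite ler_pM2r ?invr_gt0//; lra.
rewrite mulr1z => mu um.
by case: (ltP ((m i)%:~R + 1) v) => h /=; rewrite ?mulr1z ?mulr0z;
  apply/andP; split; lra.
Qed.

End dyadic.

(** * Heavy cubes and dyadic coverings *)

Section stopping.
Local Open Scope ereal_scope.
Context {R : realType} {n : nat} (delta : R).
Implicit Types (a x : 'rV[R]_n) (L : R) (p q : dyadic (n := n)).

Section family.
Context (L kappa : R) (T : countType) (I : set T) (P : T -> dyadic (n := n))
  (w : T -> R) (w_ge0 : forall i, (0 <= w i)%R).

Definition dmass q := \esum_(i in [set i | I i /\ below (P i) q]) (w i)%:E.

Definition heavy q := (kappa * dside L q `^ delta)%:E <= dmass q.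

Definition maxheavy q :=
  heavy q /\ forall j, (j < q.1)%N -> ~ heavy (ancestor q j).

Lemma heavy_maxheavy q : heavy q ->
  exists2 j, (j <= q.1)%N & maxheavy (ancestor q j).
Proof.
move=> hq.
have ex : exists j, `[< (j <= q.1)%N /\ heavy (ancestor q j) >].
  by exists q.1; apply/asboolP; rewrite ancestor_self.
have [j /asboolP[jq hj] jmin] := ex_minnP ex.
exists j => //; split => //= i ij; rewrite ancestor_ancestor ?(ltnW ij)// => hi.
suff : (j <= i)%N by rewrite leqNgt ij.
by apply/jmin/asboolP; rewrite (leq_trans (ltnW ij) jq).
Qed.

(* Maximal heavy cubes are pairwise disjoint, so the masses they carry add up. *)
Lemma maxheavy_sum : (0 < kappa)%R ->
  kappa%:E * (\esum_(q in maxheavy) (dside L q `^ delta)%:E) <=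
  \esum_(i in I) (w i)%:E.
Proof.
move=> k0.
rewrite -esumZl//; last by move=> q; rewrite lee_fin powR_ge0.
pose J q : set T := [set i | maxheavy q /\ (I i /\ below (P i) q)].
(* Two ancestors of the same [P i] are comparable, and by maximality neither is a proper ancestor of
   the other. *)
have disj q r i : J q i -> J r i -> q = r.
  move=> [mq [Ii iq]] [mr [_ ir]].
  wlog qr : q r mq mr iq ir / (q.1 <= r.1)%N.
    by move=> W; case: (leqP q.1 r.1) => [|/ltnW] h; [|apply/esym]; exact: W.
  have E : q = ancestor r q.1.
    case: iq ir => [qi qE] [ri ->] /=; rewrite ancestor_ancestor//.
    by rewrite qr.
  move: qr; rewrite leq_eqVlt => /orP[/eqP qr|lt].
    by rewrite E qr ancestor_self.
  by case: mr => _ /(_ _ lt); rewrite -E; case: mq.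
apply: (@le_trans _ _ (\esum_(q in maxheavy) \esum_(i in J q) (w i)%:E)).
  apply: le_esum => q mq; rewrite -EFinM; case: (mq) => hq _.
  by apply: (le_trans hq); apply: esum_subset => i Hi.
rewrite (esum_esum (a := fun _ i => (w i)%:E)); last by move=> *; rewrite lee_fin.
(* By [disj] the projection to [i] is injective, so no weight is counted twice. *)
rewrite -(@esum_image _ _ _ (maxheavy `*`` J) snd (fun i => (w i)%:E)).
  by apply: esum_subset => i [[q j] [_ [_ []]] ? _ <-].
move=> [q i] [r j]; rewrite !inE /= => -[_ qi] [_ rj] ij.
by rewrite -ij in rj *; rewrite (disj _ _ _ qi rj).
Qed.

End family.

(** A covering cube of side [l i <= L] is replaced by [2^n] grid cubes of side less than [2 * l i];
    this costs the factor [2^n 2^delta]. *)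
Lemma dyadic_cover a L E (c : R) : (0 < L)%R -> (0 <= delta)%R ->
  E `<=` cube a L -> hcontent delta E < c%:E ->
  exists (I : set (nat * {ffun 'I_n -> bool}))
         (P : nat * {ffun 'I_n -> bool} -> dyadic (n := n)),
    E `<=` \bigcup_(i in I) dcube a L (P i) /\
    \esum_(i in I) (dside L (P i) `^ delta)%:E <=
      ((2 ^ n)%:R * 2 `^ delta * c)%:E.
Proof.
move=> L0 d0 EQ /hcontent_cover[D [b [l [l0 cov lt]]]].
have le1 : (1 <= (2 ^ n)%:R * 2 `^ delta :> R)%R.
  rewrite -[leLHS]mulr1 ler_pM// ?ler1n ?expn_gt0//.
  by rewrite -[leLHS](powRr0 2) ler_powR// ler1n.
(* The grid has nothing coarser than the root, so a covering cube of side above [L] is replaced by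
   the root, which contains [E]. *)
have [[k [Dk Ll]]|small] := pselect (exists k, D k /\ (L < l k)%R).
  exists [set (0%N, [ffun=> false])], (fun=> (0%N, 0%R)); split.
    move=> x Ex; exists (0%N, [ffun=> false]) => //.
    by rewrite dcube_root; exact: EQ.
  rewrite esum_set1 ?lee_fin ?powR_ge0//= /dside /= expr0 divr1.
  have Lc : (L `^ delta < c)%R.
    rewrite -lte_fin; apply: le_lt_trans lt.
    apply: (le_trans _ (@esum_ge_term _ _ D (fun k => (l k `^ delta)%:E) k Dk _)).
      by rewrite lee_fin ge0_ler_powR ?nnegrE// ltW// l0.
    by rewrite lee_fin powR_ge0.
  have c0 : (0 <= c)%R by apply: le_trans (ltW Lc); rewrite powR_ge0.
  by apply: (le_trans (ltW Lc)); rewrite -[leLHS]mul1r ler_wpM2r.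
have H (i : nat) : exists k, D i -> (l i <= L / 2 ^+ k < 2 * l i)%R.
  have [Di|?] := pselect (D i); last by exists 0%N.
  have [|k Hk] := @dyadic_level R (l i) L; last by exists k.
  rewrite l0//= leNgt; apply/negP => h; apply: small; by exists i.
move/choice : H => [k Hk].
exists (D `*`` (fun=> setT)), (fun i => neighbor a L (b i.1) (k i.1) i.2); split.
  move=> x /cov[i Di xi]; have /andP[lk _] := Hk i Di.
  have [e _ xe] := cube_neighbors a L0 lk xi.
  by exists (i, e).
rewrite -(esum_esum
  (a := fun i e => (dside L (neighbor a L (b i) (k i) e) `^ delta)%:E)); last first.
  by move=> *; rewrite lee_fin powR_ge0.
apply: (@le_trans _ _ (\esum_(i in D)
    (((2 ^ n)%:R * 2 `^ delta)%:E * (`|l i| `^ delta)%:E))).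
  apply: le_esum => i Di; have /andP[_ lk] := Hk i Di.
  rewrite /dside /= esum_fin_cst ?powR_ge0//.
  rewrite card_ffun card_bool card_ord -EFinM lee_fin -mulrA ler_wpM2l//.
  rewrite -powRM// ger0_norm ?(ltW (l0 _ Di))//.
  rewrite ge0_ler_powR// ?nnegrE ?(ltW lk)//.
    by rewrite divr_ge0 ?exprn_ge0// ltW.
  by rewrite mulr_ge0// ltW// l0.
rewrite esumZl; last 2 first.
- by apply: lt_le_trans le1.
- by move=> i; rewrite lee_fin powR_ge0.
rewrite [leRHS]EFinM; apply: lee_wpmul2l; first by rewrite lee_fin (le_trans _ le1).
apply: le_trans (ltW lt); apply: le_esum => i Di.
by rewrite ger0_norm// ltW// l0.
Qed.

End stopping.

Lemma lt_ereal_rat {R : realType} (x y : \bar R) : (x < y)%E ->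
  exists q : rat, (x < (ratr q)%:E < y)%E.
Proof.
have rat01 (r s : R) : r < s -> exists q : rat, r < ratr q < s.
  move=> rs; have [q] := rat_in_itvoo rs; rewrite in_itv/= => qrs; by exists q.
case: x y => [r| |] [s| |]//.
- by rewrite lte_fin => /rat01[q ?]; exists q; rewrite !lte_fin.
- have [q /andP[rq _] _] := rat01 _ _ (ltr_pwDr ltr01 (lexx r)).
  by exists q; rewrite lte_fin rq ltry.
- have [q /andP[_ qs] _] := rat01 (s - 1) s (ltac:(by rewrite ltrBlDr ltrDl)).
  by exists q; rewrite lte_fin qs ltNyr.
- by exists 0; rewrite ltry ltNyr.
Qed.

(** * Averages, essential infima and infinite values *)

Section averages.
Local Open Scope ereal_scope.
Context {R : realType} {n : nat} (delta : R) (delta_gt0 : (0 < delta)%R)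
  (delta_le : (delta <= n%:R)%R).
Implicit Types (a : 'rV[R]_n) (l : R) (f g : 'rV[R]_n -> \bar R).

Lemma average_le a l f (c : R) : (0 < l)%R ->
  (average delta (cube a l) f <= c%:E) =
  (choquet delta (cube a l) f <= (c * l `^ delta)%:E).
Proof.
move=> l0; have p0 : (0 < l `^ delta)%R by rewrite powR_gt0.
rewrite /average hcontent_cube// inver gt_eqF// lee_pdivrMl//.
by rewrite -EFinM mulrC.
Qed.

Lemma average_ge0 a l f : (0 < l)%R -> 0 <= average delta (cube a l) f.
Proof.
move=> l0; rewrite mule_ge0 ?choquet_ge0// inve_ge0.
exact: hcontent_ge0.
Qed.

Lemma hcontent_cube_gt0 a l : (0 < l)%R -> 0 < hcontent delta (cube a l).
Proof. by move=> l0; rewrite hcontent_cube// lte_fin powR_gt0. Qed.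

Lemma hess_inf_le Q f (t : R) :
  0 < hcontent delta [set x | Q x /\ f x < t%:E] -> hess_inf delta Q f <= t%:E.
Proof. by move=> H; apply: ereal_inf_lbound; exists t. Qed.

(** By definition of the infimum, [{f < q}] is null in [Q] for each rational [q] below it, and
    countably many such sets suffice. *)
Lemma hess_inf_null Q f :
  hcontent delta [set x | Q x /\ f x < hess_inf delta Q f] = 0.
Proof.
pose F (q : rat) := [set x : 'rV[R]_n |
  (Q x /\ f x < (ratr q)%:E) /\ (ratr q)%:E < hess_inf delta Q f].
apply: (@hcontent0_subset _ _ _ _ (\bigcup_(q in [set: rat]) F q)).
  move=> x [Qx /lt_ereal_rat[q /andP[fq qh]]].
  by exists q.
apply: hcontent0_bigcup => q _; apply/eqP; rewrite eq_le hcontent_ge0 andbT.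
have [qh|qh] := leP (hess_inf delta Q f) (ratr q)%:E.
  rewrite (_ : F q = set0); last first.
    by apply/seteqP; split => // x [_]; rewrite ltNge qh.
  have := @hcontent_le_esum R n delta nat set0 (fun=> 0%R) (fun=> 0%R) set0.
  by rewrite esum_set0; apply.
rewrite leNgt; apply/negP => H.
have : hess_inf delta Q f <= (ratr q)%:E.
  apply: hess_inf_le; apply: (lt_le_trans H).
  by apply: le_hcontent => x [].
by rewrite leNgt qh.
Qed.

Lemma cube_subset_compact a l : exists2 K, compact K & cube a l `<=` K.
Proof.
pose B i : set R := `[a 0%R i, (a 0 i + l)%R]%classic.
exists [set v : 'rV[R]_n | forall i, B i (v 0%R i)].
  apply: (@rV_compact _ _ B) => i.
  exact: segment_compact.
by move=> x xa i; have /andP[xi xl] := xa i; rewrite /B /= in_itv/= (ltW xi).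
Qed.

Lemma L1loc_cube f a l : L1loc delta f ->
  choquet delta (cube a l) (fun x => `|f x|) < +oo.
Proof.
move=> Lf; have [K cK sK] := cube_subset_compact a l.
apply: le_lt_trans (Lf K cK); apply: le_choquet => t _.
by apply: le_hcontent => x [/sK].
Qed.

Lemma bigcup_cube : [set: 'rV[R]_n] `<=`
  \bigcup_(N in [set: nat]) cube (const_mx (- N.+1%:R)%R) (N.+1%:R *+ 2)%R.
Proof.
move=> x _.
have [N xN] : exists N : nat, forall i, (`|x 0%R i| < N%:R)%R.
  exists (\sum_i Num.bound `|x 0%R i|)%N => i.
  apply: (lt_le_trans (archi_boundP (normr_ge0 _))).
  by rewrite ler_nat (bigD1 i)//= leq_addr.
exists N => // i; rewrite !mxE; have := xN i; rewrite ltr_norml => /andP[h1 h2].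
rewrite -natr1; apply/andP; split; lra.
Qed.

Lemma suplevel_infty a l f : (0 < l)%R -> (forall x, 0 <= f x) ->
  choquet delta (cube a l) f < +oo ->
  hcontent delta [set x | cube a l x /\ f x = +oo] = 0.
Proof.
move=> l0 f0 fin.
have Cfin : choquet delta (cube a l) f \is a fin_num.
  by rewrite ge0_fin_numE ?choquet_ge0.
set C := choquet _ _ _ in fin Cfin.
set h := hcontent _ _.
have h0 : 0 <= h by exact: hcontent_ge0.
have H (t : R) : (0 < t)%R -> t%:E * h <= C.
  move=> t0; apply: le_trans (chebyshev delta (cube a l) f t0).
  apply: lee_wpmul2l; first by rewrite lee_fin ltW.
  by apply: le_hcontent => x [Qx fx]; split => //; rewrite fx ltry.
have hfin : h \is a fin_num.
  rewrite ge0_fin_numE//; apply: (le_lt_trans (@le_hcontent _ _ delta _ (cube a l) _)).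
    by move=> x [].
  by rewrite hcontent_cube// ltry.
rewrite -(fineK hfin); apply/eqP; rewrite eqe eq_le fine_ge0// andbT leNgt.
apply/negP => hp.
have Cp : (0 <= fine C)%R by rewrite fine_ge0// choquet_ge0.
(* This level would give [fine C + 1 <= fine C]. *)
have := H ((fine C + 1) / fine h)%R.
rewrite divr_gt0 ?ltr_wpDl// => /(_ isT).
rewrite -(fineK hfin) -EFinM divfK ?gt_eqF// -{2}(fineK Cfin) lee_fin.
by rewrite gerDl ler10.
Qed.

Lemma L1loc_fin_num f : L1loc delta f -> hae delta (fun x => f x \is a fin_num).
Proof.
move=> Lf.
pose F (N : nat) := [set x : 'rV[R]_n |
  cube (const_mx (- N.+1%:R)%R) (N.+1%:R *+ 2)%R x /\ `|f x| = +oo].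
apply: (@hcontent0_subset _ _ _ _ (\bigcup_(N in [set: nat]) F N)).
  move=> x fx; have [N _ xN] := bigcup_cube (I : [set: 'rV[R]_n] x).
  exists N => //; split => //; apply/eqP; rewrite -leye_eq leNgt.
  by apply/negP; rewrite -fin_num_abs.
apply: hcontent0_bigcup => N _; apply: suplevel_infty => //.
exact: L1loc_cube.
Qed.

Lemma hess_inf_lty a l f : (0 < l)%R ->
  hcontent delta [set x | cube a l x /\ ~ (f x \is a fin_num)] = 0 ->
  hess_inf delta (cube a l) f < +oo.
Proof.
move=> l0 null0; have Qp := hcontent_cube_gt0 a l0.
rewrite ltey; apply/eqP => moo.
pose F (k : nat) := [set x | cube a l x /\ f x < k%:R%:E].
suff null : hcontent delta (\bigcup_(k in [set: nat]) F k) = 0.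
  suff : hcontent delta (cube a l) <= 0 by rewrite leNgt Qp.
  rewrite -null; apply: hcontent_null_setU null0 => x Qx /=.
  have [fx|fx] := boolP (f x \is a fin_num); last by right; split => //; exact/negP.
  left; exists (Num.bound `|fine (f x)|) => //; split => //.
  rewrite -(fineK fx) lte_fin; apply: le_lt_trans (archi_boundP _) => //.
  exact: ler_norm.
apply: hcontent0_bigcup => k _; apply/eqP; rewrite eq_le hcontent_ge0 andbT leNgt.
by apply/negP => /hess_inf_le; rewrite moo.
Qed.

End averages.

(** * John-Nirenberg inequality *)

Section john_nirenberg.
Local Open Scope ereal_scope.
Context {R : realType} {n : nat} (delta : R) (delta_gt0 : (0 < delta)%R)
  (delta_le : (delta <= n%:R)%R).
Context (f : 'rV[R]_n -> \bar R) (f_L1loc : L1loc delta f)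
  (N : R) (N_gt0 : (0 < N)%R)
  (f_BLO : forall a l, (0 < l)%R ->
     choquet delta (cube a l)
       (fun x => `|f x - hess_inf delta (cube a l) f|) <= (N * l `^ delta)%:E).
Implicit Types (a : 'rV[R]_n) (l : R).

(** If the value were [-oo], the integrand [|f - -oo|] would be [+oo] wherever [f] is finite, that
    is almost everywhere, against a finite integral over a cube of positive content. *)
Lemma BLO_hess_inf_fin a l : (0 < l)%R ->
  hess_inf delta (cube a l) f \is a fin_num.
Proof.
move=> l0; have Qp := hcontent_cube_gt0 delta_gt0 delta_le a l0.
have fin := L1loc_fin_num delta_gt0 delta_le f_L1loc.
rewrite fin_numElt hess_inf_lty// ?andbT; last first.
  by apply: hcontent0_subset fin => x [].
rewrite ltNye; apply/eqP => moo.
have := f_BLO a l0; rewrite moo => bnd.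
have null : hcontent delta [set x | cube a l x /\ `|f x - -oo| = +oo] = 0.
  by apply: suplevel_infty => //; apply: le_lt_trans bnd _; exact: ltry.
suff : hcontent delta (cube a l) <= 0 by rewrite leNgt Qp.
rewrite -null; apply: hcontent_null_setU fin => x Qx /=.
have [fx|fx] := boolP (f x \is a fin_num); last by right; exact/negP.
by left; split => //; rewrite -(fineK fx).
Qed.

Definition excess a l (t : R) :=
  hcontent delta [set x | cube a l x /\ hess_inf delta (cube a l) f + t%:E < f x].

Lemma excess_chebyshev a l (t : R) : (0 < l)%R -> (0 < t)%R ->
  excess a l t <= (N * l `^ delta / t)%:E.
Proof.
move=> l0 t0.
have := chebyshev delta (cube a l)
  (fun x => `|f x - hess_inf delta (cube a l) f|) t0.
move=> /le_trans/(_ (f_BLO a l0)).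
rewrite -lee_pdivlMl// -EFinM mulrC; apply: le_trans.
apply: le_hcontent => x [Qx]; rewrite -(fineK (BLO_hess_inf_fin a l0)) => h.
split => //; apply: lt_le_trans (lee_abs _).
by rewrite lteBrDl// addeC.
Qed.

(** [2^n 2^delta] pays for the passage to dyadic cubes, one more [2^delta] for the passage from a
    cube to its parent. Of the 4, one factor 2 makes the covering bound strict and the other
    produces the halving. *)
Definition jn_step : R := (4 * (2 ^ n)%:R * 2 `^ delta * 2 `^ delta * N)%R.

Let p2_gt0 : (0 < 2 `^ delta :> R)%R. Proof. by rewrite powR_gt0. Qed.
Let pn_gt0 : (0 < (2 ^ n)%:R :> R)%R. Proof. by rewrite ltr0n expn_gt0. Qed.

Lemma jn_step_gt0 : (0 < jn_step)%R.
Proof. by rewrite /jn_step !mulr_gt0. Qed.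

(* Stop at the maximal dyadic cubes whose share of a near-optimal covering of the
   level set is at least their own content: their parents are not covered by the
   level set, so passing to the essential infimum of a parent costs at most
   jn_step. *)
Lemma excess_halve (q t : R) : (0 < q)%R -> (0 <= t)%R ->
  (forall a l, (0 < l)%R -> excess a l t <= (q * l `^ delta)%:E) ->
  forall a l, (0 < l)%R -> excess a l (jn_step + t) <= (q / 2 * l `^ delta)%:E.
Proof.
move=> q0 t0 Ht a l l0; have s0 := jn_step_gt0; set s := jn_step in s0 *.
have ld0 : (0 < l `^ delta)%R by rewrite powR_gt0.
set m := hess_inf delta (cube a l) f.
have mfin : m \is a fin_num by exact: BLO_hess_inf_fin.
pose E := [set x | cube a l x /\ m + s%:E < f x].
have EQ : E `<=` cube a l by move=> x [].
pose c := (2 * N * l `^ delta / s)%R.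
have Ec : hcontent delta E < c%:E.
  apply: (le_lt_trans (excess_chebyshev a l0 s0)).
  by rewrite lte_fin /c ltr_pM2r ?invr_gt0// ltr_pM2r// ltr_pMl// ltr1n.
have [I [P [Ecov Psum]]] := dyadic_cover l0 (ltW delta_gt0) EQ Ec.
have cE : ((2 ^ n)%:R * 2 `^ delta * c = l `^ delta / 2 / 2 `^ delta)%R.
  rewrite /c /s /jn_step; field.
  by rewrite !gt_eqF.
rewrite cE in Psum.
pose w i := (dside l (P i) `^ delta)%R.
have w0 i : (0 <= w i)%R by exact: powR_ge0.
pose heavy' := heavy delta l 1 I P w.
have heavyP i : I i -> heavy' (P i).
  move=> Ii; rewrite /heavy' /heavy mul1r.
  apply: (@esum_ge_term _ _ _ (fun j => (w j)%:E) i); last by rewrite lee_fin.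
  by split => //; exact: belowxx.
(* Meeting [E] forces a cube of the grid into the root, so its ancestors stay inside [cube a l]. *)
pose S := [set q | maxheavy delta l 1 I P w q /\ exists x, E x /\ dcube a l q x].
pose parent (r : dyadic (n := n)) := ancestor r r.1.-1.
have Sbig r x : E x -> dcube a l r x -> (0 < l)%R -> ancestor r 0 = (0%N, 0%R).
  move=> Ex rx _; apply/esym/(@ancestorE _ _ a l r (0%N, 0%R) x) => //.
  by rewrite dcube_root; exact: EQ.
(* The root is not heavy: the total weight is at most [l^delta / 2 / 2^delta], less than [l^delta].
   Hence selected cubes have a parent in the grid. *)
have S1 r : S r -> (0 < r.1)%N.
  move=> [[hr _] [x [Ex rx]]]; rewrite lt0n; apply/eqP => r0.
  have rE : r = (0%N, 0%R).
    by rewrite -(Sbig r x)// -r0 ancestor_self.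
  move: hr; rewrite /heavy rE mul1r /dside /= expr0 divr1 leNgt => /negP; apply.
  apply: (@le_lt_trans _ _ (l `^ delta / 2 / 2 `^ delta)%:E).
    by apply: le_trans Psum; apply: esum_subset => j [].
  rewrite lte_fin ltr_pdivrMr//.
  have p1 : (1 <= 2 `^ delta :> R)%R.
    by rewrite -[leLHS](powRr0 2) ler_powR ?ler1n// ltW.
  by have := ler_peMr (ltW ld0) p1; lra.
have parentS r : S r -> hess_inf delta (dcube a l (parent r)) f <= m + s%:E.
  move=> Sr; have r1 := S1 _ Sr; case: (Sr) => -[hr rmax] [x [Ex rx]].
  have pr : (r.1.-1 < r.1)%N by rewrite prednK.
  have px : dcube a l (parent r) x by apply: dcube_ancestor rx => //; exact: ltnW.
  have pQ : dcube a l (parent r) `<=` cube a l.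
    rewrite -dcube_root -(Sbig _ _ Ex px l0).
    exact: dcube_ancestor.
  have light : dmass I P w (parent r) < (dside l (parent r) `^ delta)%:E.
    by rewrite ltNge; apply/negP => h; apply: (rmax _ pr); rewrite /heavy mul1r.
  (* A covering cube that meets the parent either lies below it and is counted in its mass, or is
     strictly larger; the latter would be a heavy proper ancestor of [r]. *)
  have Hmass : hcontent delta (dcube a l (parent r) `&` E) <=
      dmass I P w (parent r).
    apply: (@hcontent_le_esum _ _ delta _ _
      (fun i => (a + dside l (P i) *: map_mx intr (P i).2)%R)
      (fun i => dside l (P i))).
      by move=> i _; exact: dside_gt0.
    move=> y [py Ey]; have [i Ii yi] := Ecov y Ey.
    exists i => //=; split => //.
    have [le|lt] := leqP (parent r).1 (P i).1.
      by split => //; exact: ancestorE py.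
    have Pi : P i = ancestor r (P i).1.
      rewrite -(ancestor_ancestor (i := r.1.-1)) ?(ltnW pr) ?(ltnW lt)//.
      exact: (ancestorE l0 (ltnW lt) py yi).
    exfalso; apply: (rmax (P i).1); first exact: ltn_trans lt pr.
    by rewrite -Pi; exact: heavyP.
  have Hdiff : 0 < hcontent delta (dcube a l (parent r) `\` E).
    rewrite lt_neqAle hcontent_ge0 andbT eq_sym; apply/eqP => null.
    have : hcontent delta (dcube a l (parent r)) <=
           hcontent delta (dcube a l (parent r) `&` E).
      apply: hcontent_null_setU null => y py.
      by have [Ey|nEy] := pselect (E y); [left|right].
    rewrite {1}/dcube hcontent_cube ?dside_gt0// => /le_trans/(_ Hmass).
    by rewrite leNgt light.
  (* Outside [E] only the weak inequality [f <= m + s] holds, while [hess_inf] is defined with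
     strict sublevels; hence the [e]. *)
  apply/lee_addgt0Pr => e e0.
  have -> : m + s%:E + e%:E = (fine m + s + e)%:E by rewrite !EFinD fineK.
  apply: hess_inf_le; apply: (lt_le_trans Hdiff); apply: le_hcontent => y [py nEy].
  split => //; rewrite ltNge; apply/negP => fy; apply: nEy; split; first exact: pQ.
  by apply: lt_le_trans fy; rewrite -(fineK mfin) -EFinD lte_fin ltrDl.
pose M r := [set x | dcube a l (parent r) x /\
  hess_inf delta (dcube a l (parent r)) f + t%:E < f x].
have cov : [set x | cube a l x /\ m + (s + t)%:E < f x] `<=` \bigcup_(r in S) M r.
  move=> x [Qx fx].
  have Ex : E x.
    split => //; apply: le_lt_trans fx; rewrite leeD2l// lee_fin.
    by rewrite lerDl.
  have [i Ii xi] := Ecov x Ex.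
  have [j ji mj] := heavy_maxheavy (heavyP i Ii).
  have xr : dcube a l (ancestor (P i) j) x by exact: dcube_ancestor xi.
  have Sr : S (ancestor (P i) j) by split => //; exists x.
  exists (ancestor (P i) j) => //; split.
    by apply: dcube_ancestor xr => //; exact: leq_pred.
  apply: le_lt_trans fx; rewrite EFinD addeA leeD2r//; exact: parentS.
apply: (le_trans (le_hcontent _ cov)).
apply: (le_trans (hcontent_bigcup _ _ _)).
(* The hypothesis at height [t] is applied on each parent, whose side is twice that of [r]. *)
apply: (@le_trans _ _ (\esum_(r in S) ((q * 2 `^ delta)%:E * (dside l r `^ delta)%:E))).
  apply: le_esum => r Sr; apply: (le_trans (Ht _ _ (dside_gt0 (parent r) l0))).
  rewrite -EFinM lee_fin -mulrA ler_pM2l// -powRM//; last first.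
    exact/ltW/dside_gt0.
  rewrite le_eqVlt; apply/orP; left; apply/eqP; congr (_ `^ _)%R.
  rewrite /dside /parent /= -{2}(prednK (S1 _ Sr)) exprS; field.
  by rewrite expf_neq0.
rewrite esumZl ?mulr_gt0//; last by move=> r; rewrite lee_fin powR_ge0.
apply: (@le_trans _ _ ((q * 2 `^ delta)%:E * (l `^ delta / 2 / 2 `^ delta)%:E)).
  apply: lee_wpmul2l; first by rewrite lee_fin mulr_ge0 ?ltW.
  apply: le_trans Psum.
  have := maxheavy_sum delta l I P w0 (@ltr01 R).
  rewrite mul1e; apply: le_trans; apply: esum_subset => r [].
  by [].
rewrite -EFinM lee_fin le_eqVlt; apply/orP; left; apply/eqP; field.
by rewrite gt_eqF.
Qed.

Lemma john_nirenberg k a l : (0 < l)%R ->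
  excess a l (jn_step *+ k) <= (l `^ delta / 2 ^+ k)%:E.
Proof.
move=> l0; rewrite [(_ / _)%R]mulrC.
elim: k a l l0 => [|k IH] a l l0.
  rewrite expr0 invr1 mul1r -(hcontent_cube a delta_gt0 delta_le l0).
  by apply: le_hcontent => x [].
rewrite mulrS exprS invfM [(2^-1 * _)%R]mulrC.
apply: excess_halve => //.
by rewrite mulrn_wge0// ltW// jn_step_gt0.
Qed.

End john_nirenberg.

(** * Lower bound for the maximal function *)

Section maximal_lower_bound.
Local Open Scope ereal_scope.
Context {R : realType} {n : nat} (delta : R) (delta_gt0 : (0 < delta)%R)
  (delta_le : (delta <= n%:R)%R).
Implicit Types (a : 'rV[R]_n) (l : R) (E : set 'rV[R]_n).

Lemma compact_subset_cube (K : set 'rV[R]_n) : compact K ->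
  exists a l, (0 < l)%R /\ K `<=` cube a l.
Proof.
move=> cK.
have H (i : 'I_n) : exists M : R, (0 < M)%R /\ forall x, K x -> (`|x 0%R i| <= M)%R.
  have : compact ((fun x : 'rV[R]_n => x 0%R i) @` K).
    apply: continuous_compact => //; apply: continuous_subspaceT => x.
    exact: coord_continuous.
  move=> /compact_bounded[M [_ HM]]; exists (`|M| + 1)%R; split.
    by rewrite ltr_wpDl.
  move=> x Kx; apply: (HM (`|M| + 1)%R); last by exists x.
  by rewrite (le_lt_trans (ler_norm _))// ltrDl.
move/choice : H => [M HM].
pose B : R := (1 + \sum_i M i)%R.
have MB i : (M i < B)%R.
  rewrite /B (bigD1 i)//= addrCA ltrDl ltr_wpDr//.
  by apply: sumr_ge0 => j _; have [/ltW] := HM j.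
have B0 : (0 < B)%R.
  rewrite /B ltr_wpDr//.
  by apply: sumr_ge0 => j _; have [/ltW] := HM j.
exists (const_mx (- B)%R), (2 * B)%R; split; first by rewrite mulr_gt0.
move=> x Kx i; rewrite mxE; have [_ /(_ _ Kx)] := HM i.
rewrite ler_norml => /andP[h1 h2]; have := MB i => h3.
by apply/andP; split; lra.
Qed.

(* If a set meets each cube through its points in less than half of the content of
   that cube, the cubes of a near-optimal covering show that it is null. *)
Lemma hae_dense_cube E : hae delta (fun x => E x ->
  exists a l, [/\ (0 < l)%R, cube a l x &
    (l `^ delta / 2)%:E <= hcontent delta (cube a l `&` E)]).
Proof.
pose A := [set x | E x /\ forall a l, (0 < l)%R -> cube a l x ->
  hcontent delta (cube a l `&` E) < (l `^ delta / 2)%:E].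
(* Cutting with bounded cubes makes the content finite, as the comparison with a near-optimal
   covering requires. *)
pose F (N : nat) := A `&` cube (const_mx (- N.+1%:R)%R) (N.+1%:R *+ 2)%R.
apply: (@hcontent0_subset _ _ _ _ (\bigcup_(N in [set: nat]) F N)).
  move=> x /= /not_implyP[Ex nx]; have [N _ xN] := bigcup_cube (I : [set: 'rV[R]_n] x).
  exists N => //; split => //; split => // a l l0 xa.
  rewrite ltNge; apply/negP => h; apply: nx; by exists a, l.
apply: hcontent0_bigcup => N _; set B := F N.
have Bfin : hcontent delta B \is a fin_num.
  rewrite ge0_fin_numE ?hcontent_ge0//.
  apply: (@le_lt_trans _ _ (hcontent delta
      (cube (const_mx (- N.+1%:R)%R) (N.+1%:R *+ 2)%R))).
    by apply: le_hcontent => x [].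
  by rewrite hcontent_cube ?ltry.
have := hcontent_ge0 delta B; rewrite -(fineK Bfin).
set h := fine _; rewrite lee_fin le_eqVlt => /predU1P[<-//|h0].
(* Any factor strictly between 1 and 2 would do: half of the covering sum must stay below [h]. *)
have : hcontent delta B < (3 / 2 * h)%:E.
  by rewrite -(fineK Bfin) lte_fin -/h; lra.
move=> /hcontent_cover[D [b [r [r0 cov lt]]]].
pose D' := [set k | D k /\ exists x, B x /\ cube (b k) (r k) x].
have : hcontent delta B <= \esum_(k in D') ((1 / 2)%:E * (r k `^ delta)%:E).
  apply: (@le_trans _ _ (hcontent delta (\bigcup_(k in D') (cube (b k) (r k) `&` B)))).
    apply: le_hcontent => x Bx; have [k Dk xk] := cov x Bx.
    by exists k => //; split => //; exists x.
  apply: (le_trans (hcontent_bigcup _ _ _)); apply: le_esum => k [Dk [x [Bx xk]]].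
  have [[_ /(_ _ _ (r0 k Dk) xk)/ltW + _]] := Bx.
  rewrite -EFinM [(1 / 2 * _)%R](_ : _ = r k `^ delta / 2)%R; last by ring.
  apply: le_trans; apply: le_hcontent => y [yk [[Ey _] _]]; split => //.
rewrite esumZl ?divr_gt0//; last by move=> k; rewrite lee_fin powR_ge0.
have : (1 / 2)%:E * (\esum_(k in D') (r k `^ delta)%:E) <= (1 / 2)%:E * (3 / 2 * h)%:E.
  apply: lee_wpmul2l; first by rewrite lee_fin divr_ge0.
  apply: le_trans (ltW lt); apply: esum_subset => k [].
  by [].
move=> le1 /le_trans/(_ le1); rewrite -(fineK Bfin) -/h -EFinM lee_fin.
move=> le2; exfalso; lra.
Qed.

Lemma average_le_maximal a l (g : 'rV[R]_n -> \bar R) x :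
  (0 < l)%R -> cube a l x ->
  average delta (cube a l) (fun y => `|g y|) <= maximal delta g x.
Proof. by move=> l0 xa; apply: ereal_sup_ubound; exists a, l. Qed.

(** If [M g x < g x / 2], take a rational [q] between [2 M g x] and [g x]. Off a null set, [{g > q}]
    fills half of some cube through [x], whose average is then at least [q / 2 > M g x]. Rational
    [q] keep the exceptional sets countable in number. *)
Lemma hae_half_le_maximal (g : 'rV[R]_n -> R) : (forall x, 0 <= g x)%R ->
  hae delta (fun x => (g x / 2)%:E <= maximal delta (EFin \o g) x).
Proof.
move=> g0; pose E (q : rat) := [set x | ratr q < g x]%R.
pose F (q : rat) := [set x | ~ (E q x -> exists a l, [/\ (0 < l)%R, cube a l x &
    (l `^ delta / 2)%:E <= hcontent delta (cube a l `&` E q)])].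
apply: (@hcontent0_subset _ _ _ _ (\bigcup_(q in [set: rat]) F q)); last first.
  by apply: hcontent0_bigcup => q _; exact: hae_dense_cube.
move=> x /= /negP; rewrite -ltNge => Mx.
have M0 : 0 <= maximal delta (EFin \o g) x.
  have [N _ xN] := bigcup_cube (I : [set: 'rV[R]_n] x).
  apply: le_trans (average_le_maximal (EFin \o g) _ xN); last by rewrite pmulrn_lgt0.
  by apply: average_ge0 => //; rewrite pmulrn_lgt0.
have Mfin : maximal delta (EFin \o g) x \is a fin_num.
  by rewrite ge0_fin_numE// (lt_trans Mx)// ltry.
move: Mx M0; rewrite -(fineK Mfin) lte_fin lee_fin; set m := fine _ => mg m0.
have [q] := @rat_in_itvoo R (2 * m)%R (g x) (ltac:(lra)).
rewrite in_itv/= => /andP[mq qg].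
exists q => // /(_ qg)[a [l [l0 xa half]]].
have q0 : (0 < ratr q :> R)%R by lra.
have : (ratr q / 2)%:E <= maximal delta (EFin \o g) x.
  apply: le_trans (average_le_maximal _ l0 xa).
  have ld0 : (0 < l `^ delta)%R by rewrite powR_gt0.
  rewrite /average hcontent_cube// inver gt_eqF// lee_pdivlMl// -EFinM.
  apply: le_trans (chebyshev delta _ _ q0).
  apply: (@le_trans _ _ ((ratr q)%:E * (l `^ delta / 2)%:E)).
    by rewrite -EFinM lee_fin le_eqVlt; apply/orP; left; apply/eqP; ring.
  apply: lee_wpmul2l; first by rewrite lee_fin ltW.
  apply: (le_trans half); apply: le_hcontent => y [ya Ey]; split => //=.
  by rewrite lte_fin ger0_norm.
rewrite -(fineK Mfin) lee_fin -/m => h; lra.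
Qed.

End maximal_lower_bound.

(** * The exponential of a BLO function *)

Section exponential_of_BLO.
Local Open Scope ereal_scope.
Context {R : realType} {n : nat} (delta : R) (delta_gt0 : (0 < delta)%R)
  (delta_le : (delta <= n%:R)%R).
Context (f : 'rV[R]_n -> \bar R) (f_L1loc : L1loc delta f)
  (N : R) (N_gt0 : (0 < N)%R)
  (f_BLO : forall a l, (0 < l)%R ->
     choquet delta (cube a l)
       (fun x => `|f x - hess_inf delta (cube a l) f|) <= (N * l `^ delta)%:E).
Implicit Types (a : 'rV[R]_n) (l : R).

Let s := jn_step delta N (n := n).
(** Chosen so that a factor [2^k] in [exp (f / alpha)] corresponds to [2 * k] John-Nirenberg steps
    in [f]: the level sets then decay like [4^-k], as [choquet_pow_le] needs. *)
Definition BLO_alpha : R := (2 * s / ln 2)%R.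
(** Where [f] is infinite, a null set, [fine] makes the value 1. *)
Definition BLO_exp (x : 'rV[R]_n) : R := expR (fine (f x) / BLO_alpha).

Let ln2_gt0 : (0 < ln 2 :> R)%R. Proof. by rewrite ln_gt0// ltr1n. Qed.
Let s_gt0 : (0 < s)%R. Proof. exact: jn_step_gt0. Qed.

Lemma BLO_alpha_gt0 : (0 < BLO_alpha)%R.
Proof. by rewrite divr_gt0// mulr_gt0. Qed.

Lemma choquet_BLO_exp_le a l : (0 < l)%R ->
  choquet delta (cube a l) (fun x => `|(BLO_exp x)%:E|) <=
    (3 * expR (fine (hess_inf delta (cube a l) f) / BLO_alpha) * l `^ delta)%:E.
Proof.
move=> l0; set m := fine _.
have mE : hess_inf delta (cube a l) f = m%:E.
  by rewrite fineK// (BLO_hess_inf_fin delta_gt0 delta_le f_L1loc f_BLO).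
apply: choquet_pow_le; rewrite ?expR_gt0 ?powR_ge0//.
  by rewrite -(hcontent_cube a delta_gt0 delta_le l0); exact: suplevel_le.
move=> k.
have -> : (4 ^+ k = 2 ^+ (2 * k) :> R)%R.
  by rewrite exprM; congr (_ ^+ _)%R; ring.
apply: (le_trans _ (john_nirenberg delta_gt0 delta_le f_L1loc N_gt0 f_BLO (2 * k) a l0)).
apply: hcontent_null_setU (L1loc_fin_num delta_gt0 delta_le f_L1loc).
move=> x [Qx gx] /=.
have [fx|fx] := boolP (f x \is a fin_num); last by right; exact/negP.
left; split => //; rewrite mE -(fineK fx) -EFinD lte_fin.
move: gx; rewrite /= lte_fin ger0_norm ?expR_ge0// /BLO_exp.
have -> : (2 ^+ k = expR (ln 2 *+ k) :> R)%R.
  by rewrite -[(ln 2 *+ k)%R]mulr_natr expRM_natr lnK ?posrE.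
rewrite -expRD ltr_expR ltr_pdivlMr ?BLO_alpha_gt0//; apply: le_lt_trans.
rewrite mulrDl divfK ?gt_eqF ?BLO_alpha_gt0// lerD2l -/s.
rewrite -[(s *+ _)%R]mulr_natr -[(ln 2 *+ k)%R]mulr_natr natrM.
rewrite /BLO_alpha -/s le_eqVlt; apply/orP; left; apply/eqP.
by field; rewrite gt_eqF.
Qed.

Lemma L1loc_BLO_exp : L1loc delta (EFin \o BLO_exp).
Proof.
move=> K cK; have [a [l [l0 Kal]]] := compact_subset_cube cK.
apply: (@le_lt_trans _ _ (choquet delta (cube a l) (fun x => `|(BLO_exp x)%:E|))).
  by apply: le_choquet => t _; apply: le_hcontent => x [/Kal].
by apply: le_lt_trans (choquet_BLO_exp_le a l0) _; rewrite ltry.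
Qed.

(** The corner moves down by less than [l] and the side exceeds [2 * l], so the upper faces still
    reach beyond those of the given cube. *)
Lemma rat_cube a l : (0 < l)%R -> exists p : 'rV[rat]_n * rat,
  let l' := ratr p.2 in let a' := map_mx ratr p.1 in
  [/\ (0 < l')%R, (l' <= 3 * l)%R & cube a l `<=` cube a' l'].
Proof.
move=> l0.
have H (i : 'I_n) : exists q : rat, (a 0%R i - l < ratr q < a 0%R i)%R.
  have [|q] := @rat_in_itvoo R (a 0%R i - l) (a 0%R i).
    by rewrite ltrBlDr ltrDl.
  by rewrite in_itv/= => h; exists q.
move/choice : H => [b Hb].
have [|q] := @rat_in_itvoo R (2 * l) (3 * l); first by rewrite ltr_pM2r// ltr_nat.
rewrite in_itv/= => /andP[q1 q2].
exists (\row_i b i, q); split => /=; [lra|lra|].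
move=> x xa i; rewrite !mxE; have /andP[h1 h2] := xa i; have /andP[h3 h4] := Hb i.
by apply/andP; split; lra.
Qed.

(* Every cube sits in a rational cube of comparable size, so one null set serves for
   all cubes at once. *)
Lemma hae_maximal_BLO_exp_le : hae delta (fun x =>
  maximal delta (EFin \o BLO_exp) x <= (3 * 3 `^ delta * BLO_exp x)%:E).
Proof.
pose Q (p : 'rV[rat]_n * rat) : set 'rV[R]_n := cube (map_mx ratr p.1) (ratr p.2).
pose F p := [set x | Q p x /\ f x < hess_inf delta (Q p) f].
pose F0 := [set x | ~ (f x \is a fin_num)].
have null : hcontent delta ((\bigcup_(p in setT) F p) `|` F0) = 0.
  apply/eqP; rewrite eq_le hcontent_ge0 andbT.
  apply: (le_trans (hcontent_setU _ _ _)).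
  rewrite (L1loc_fin_num delta_gt0 delta_le f_L1loc) adde0.
  by rewrite hcontent0_bigcup// => p _; exact: hess_inf_null.
apply: hcontent0_subset null => x; apply: contra_notP => /not_orP[nF /contrapT fx].
apply: ge_ereal_sup => _ [a [l [l0 xa ->]]].
have [p [p0 pl ap]] := rat_cube a l0.
have px : Q p x by exact: ap.
have mp : hess_inf delta (Q p) f <= f x.
  by rewrite leNgt; apply/negP => h; apply: nF; exists p.
rewrite average_le//.
apply: (@le_trans _ _ (choquet delta (Q p) (fun x => `|(BLO_exp x)%:E|))).
  by apply: le_choquet => t _; apply: le_hcontent => y [/ap].
apply: (le_trans (choquet_BLO_exp_le _ p0)); rewrite lee_fin.
rewrite -!mulrA ler_pM2l// [leRHS]mulrCA.
have mfin := BLO_hess_inf_fin delta_gt0 delta_le f_L1loc f_BLO (map_mx ratr p.1) p0.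
apply: ler_pM; rewrite ?expR_ge0 ?powR_ge0//.
  rewrite ler_expR ler_pM2r ?invr_gt0 ?BLO_alpha_gt0//.
  by apply: fine_le.
rewrite -powRM ?(ltW l0)// ge0_ler_powR ?nnegrE ?(ltW delta_gt0) ?(ltW p0)//.
by rewrite mulr_ge0// ltW.
Qed.

End exponential_of_BLO.

Lemma BLO_norm_ge0 {R : realType} {n : nat} (delta : R) (f : 'rV[R]_n -> \bar R) :
  (0 <= BLO_norm delta f)%E.
Proof.
apply: (@le_trans _ _ (average delta (cube 0 1)
  (fun x => `|f x - hess_inf delta (cube 0 1) f|%E))).
  exact: average_ge0.
by apply: ereal_sup_ubound; exists 0, 1; split.
Qed.

Lemma BLO_decomposition {R : realType} {n : nat} {delta : R} :
  0 < delta -> delta <= n%:R ->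
  exists C : R, 0 < C /\
    forall f : 'rV[R]_n -> \bar R,
      BLO delta f -> BLO_norm delta f <> 0%E ->
      exists (alpha : R) (b g : 'rV[R]_n -> R),
        [/\ 0 < alpha,
            Linfty delta (EFin \o b),
            L1loc delta (EFin \o g),
            hae delta (fun x =>
              f x = (alpha%:E * lne (maximal delta (EFin \o g) x)
                     + (b x)%:E)%E) &
            (alpha%:E + Linfty_norm delta (EFin \o b)
             <= C%:E * BLO_norm delta f)%E].
Proof.
move=> d0 dn.
(* The upper bound for [M g / g]. Since it exceeds 2 it also serves for the lower bound, and
   [|b| <= alpha ln K] follows. *)
pose K : R := 3 * 3 `^ delta.
have K3 : 3 <= K.
  rewrite /K ler_peMr// -[leLHS](powRr0 3) ler_powR ?ler1n// ltW//.
have lnK0 : 0 < ln K by rewrite ln_gt0//; lra.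
have ln2_gt0 : 0 < ln 2 :> R by rewrite ln_gt0// ltr1n.
pose C1 : R := BLO_alpha delta 1 (n := n).
have C10 : 0 < C1 by exact: BLO_alpha_gt0.
exists (C1 * (1 + ln K)); split; first by rewrite mulr_gt0// addr_gt0.
move=> f [fL fN] fN0.
have Nfin : BLO_norm delta f \is a fin_num by rewrite ge0_fin_numE ?BLO_norm_ge0.
pose N := fine (BLO_norm delta f).
have NE : BLO_norm delta f = N%:E by rewrite fineK.
have N0 : 0 < N.
  rewrite lt_neqAle fine_ge0 ?BLO_norm_ge0// andbT eq_sym; apply/eqP => N0.
  by apply: fN0; rewrite NE N0.
have fB a l : 0 < l -> (choquet delta (cube a l)
       (fun x => `|f x - hess_inf delta (cube a l) f|) <= (N * l `^ delta)%:E)%E.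
  move=> l0; rewrite -average_le// -NE; apply: ereal_sup_ubound.
  by exists a, l.
pose alpha := BLO_alpha delta N (n := n).
have alpha0 : 0 < alpha by exact: BLO_alpha_gt0.
(* Linearity of [alpha] in the norm makes the final constant independent of [f]. *)
have alphaE : alpha = C1 * N by rewrite /alpha /C1 /BLO_alpha /jn_step; ring.
pose g := BLO_exp delta f N.
pose Mg x := maximal delta (EFin \o g) x.
pose b x := fine (f x) - alpha * ln (fine (Mg x)).
have g0 x : 0 < g x by exact: expR_gt0.
pose good x := [/\ f x \is a fin_num, ((g x / 2)%:E <= Mg x)%E &
  (Mg x <= (K * g x)%:E)%E].
have good_ae : hae delta good.
  have n1 := L1loc_fin_num d0 dn fL.
  have n2 : hae delta (fun x => ((g x / 2)%:E <= Mg x)%E).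
    by apply: hae_half_le_maximal => // x; exact: ltW.
  have n3 := hae_maximal_BLO_exp_le d0 dn fL N0 fB.
  apply/eqP; rewrite eq_le hcontent_ge0 andbT.
  apply: le_trans (_ : hcontent delta ([set x | ~ (f x \is a fin_num)] `|`
    [set x | ~ ((g x / 2)%:E <= Mg x)%E]) <= 0)%E; last first.
    by apply: le_trans (hcontent_setU _ _ _) _; rewrite n1 n2 adde0.
  apply: hcontent_null_setU n3 => x /=.
  by move=> /not_and3P[]; [left; left|left; right|right].
have goodP x : good x -> [/\ f x = (fine (f x))%:E, Mg x = (fine (Mg x))%:E,
    0 < fine (Mg x) & `|b x| <= alpha * ln K].
  move=> [ffin lo hi].
  have Mfin : Mg x \is a fin_num.
    rewrite fin_numElt (lt_le_trans _ lo) ?ltNyr//=.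
    by rewrite (le_lt_trans hi) ?ltry.
  move: lo hi; rewrite -(fineK Mfin) !lee_fin; set y := fine (Mg x) => lo hi.
  have y0 : 0 < y by apply: lt_le_trans lo; rewrite divr_gt0.
  have fg : fine (f x) = alpha * ln (g x).
    by rewrite /g /BLO_exp expRK -/alpha mulrC divfK// gt_eqF.
  split=> //; first by rewrite fineK.
  rewrite /b fg -/y -mulrBr normrM gtr0_norm// ler_pM2l//.
  have l1 : ln y <= ln K + ln (g x).
    by rewrite -lnM ?posrE//; [rewrite ler_ln ?posrE// mulr_gt0//; lra|lra].
  have l2 : ln (g x) <= ln K + ln y.
    rewrite -lnM ?posrE//; [|lra].
    by rewrite ler_ln ?posrE//; [nra|rewrite mulr_gt0//; lra].
  by rewrite ler_norml; apply/andP; split; lra.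
have bN : (Linfty_norm delta (EFin \o b) <= (alpha * ln K)%:E)%E.
  apply: ereal_inf_lbound; exists (alpha * ln K) => //; split.
    by rewrite mulr_gt0.
  apply: hcontent0_subset good_ae => x /= bx /goodP[_ _ _].
  by move: bx; rewrite lte_fin ltNge => /negP.
exists alpha, b, g; split => //.
- by rewrite /Linfty (le_lt_trans bN)// ltry.
- exact: L1loc_BLO_exp.
- apply: hcontent0_subset good_ae => x /=; apply: contra_not => /goodP[fE ME y0 _].
  rewrite -/(Mg x) ME lne_EFin// -EFinM -EFinD {1}fE.
  by congr _%:E; rewrite /b addrC subrK.
- apply: (@le_trans _ _ (alpha%:E + (alpha * ln K)%:E)%E); first exact: leeD2l.
  by rewrite NE -EFinD -EFinM lee_fin alphaE le_eqVlt; apply/orP; left;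
    apply/eqP; ring.
Qed.

(** * Weak type estimate for the maximal operator *)

Section weak_type.
Local Open Scope ereal_scope.
Context {R : realType} {n : nat} (delta : R) (delta_gt0 : (0 < delta)%R)
  (delta_le : (delta <= n%:R)%R).
Implicit Types (a b x : 'rV[R]_n) (l L p : R) (q : dyadic (n := n)).

Definition triple a L q : set 'rV[R]_n :=
  cube (a + dside L q *: map_mx intr q.2 - const_mx (dside L q))%R (3 * dside L q)%R.

Lemma near_triple a L q x y : dcube a L q y ->
  (forall i, `|x 0%R i - y 0%R i| <= dside L q)%R -> triple a L q x.
Proof.
move=> yq xy i; have := yq i; have := xy i; rewrite !mxE ler_norml.
by move=> /andP[h1 h2] /andP[h3 h4]; apply/andP; split; lra.
Qed.

Lemma dside_ancestor L q j : (0 < L)%R -> (j <= q.1)%N ->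
  (dside L q <= dside L (ancestor q j))%R.
Proof.
move=> L0 jq; rewrite /dside /= ler_pM2l// lef_pV2 ?posrE ?exprn_gt0//.
by rewrite ler_eXn2l ?ltr1n.
Qed.

(** Neighbors are translates of one another by at most one grid step per coordinate. So when one
    neighbor of a cube is heavy, every point of the cube lies in its triple. *)
Lemma neighbor_shift a L b k e e' x : (0 < L)%R -> dcube a L (neighbor a L b k e) x ->
  exists2 y, dcube a L (neighbor a L b k e') y &
    forall i, (`|x 0%R i - y 0%R i| <= L / 2 ^+ k)%R.
Proof.
move=> L0 /(dcubeP _ _ _ L0) xe; set s := (L / 2 ^+ k)%R.
have s0 : (0 < s)%R by rewrite divr_gt0 ?exprn_gt0.
exists (\row_i (x 0 i + ((e' i : nat)%:R - (e i : nat)%:R) * s))%R; last first.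
  move=> i; rewrite mxE opprD addrA subrr sub0r normrN normrM (gtr0_norm s0).
  rewrite ler_piMl ?(ltW s0)//.
  by case: (e' i) (e i) => [] [] /=; rewrite ler_norml; apply/andP; split; lra.
apply/dcubeP => // i; have := xe i.
rewrite /neighbor !mxE /dside /= -/s !intrD -!pmulrn.
have -> : ((x 0 i + ((e' i : nat)%:R - (e i : nat)%:R) * s - a 0 i) / s =
  (x 0 i - a 0 i) / s + ((e' i : nat)%:R - (e i : nat)%:R) :> R)%R.
  by field; rewrite gt_eqF.
by move=> /andP[h1 h2]; apply/andP; split; lra.
Qed.

Definition weak_cst : R := ((2 ^ n)%:R * 2 `^ delta)%R.

Lemma weak_cst_ge1 : (1 <= weak_cst)%R.
Proof.
rewrite -[leLHS]mulr1 ler_pM// ?ler1n ?expn_gt0//.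
by rewrite -[leLHS](powRr0 2) ler_powR ?ler1n// ltW.
Qed.

Section one_level.
Context (f : 'rV[R]_n -> \bar R) (a : 'rV[R]_n) (L J tau : R)
  (L_gt0 : (0 < L)%R) (J_gt0 : (0 < J)%R) (tau_gt0 : (0 < tau)%R)
  (f_int : choquet delta (cube a L) f <= J%:E).

Let E k := [set x | cube a L x /\ (tau * 2 ^+ k)%:E < f x].

(** The error [J / (tau 4^k)] allowed at level [k] has weighted sum [2 * J], and [dyadic_le_choquet]
    bounds the main part by [2 * J]; [weak_cst] is the loss in [dyadic_cover]. *)
Let covers : exists IP : nat -> set (nat * {ffun 'I_n -> bool}) *
    (nat * {ffun 'I_n -> bool} -> dyadic (n := n)),
  (forall k, E k `<=` \bigcup_(i in (IP k).1) dcube a L ((IP k).2 i)) /\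
  \esum_(k in [set: nat]) ((tau * 2 ^+ k)%:E *
     \esum_(i in (IP k).1) (dside L ((IP k).2 i) `^ delta)%:E) <=
     (4 * weak_cst * J)%:E.
Proof.
pose c k := (fine (hcontent delta (E k)) + J / (tau * 4 ^+ k))%R.
have Efin k : hcontent delta (E k) \is a fin_num.
  rewrite ge0_fin_numE ?hcontent_ge0//.
  apply: (le_lt_trans (@le_hcontent _ _ delta _ (cube a L) _)).
    by move=> x [].
  by rewrite hcontent_cube// ltry.
have H k : exists IP : set (nat * {ffun 'I_n -> bool}) *
    (nat * {ffun 'I_n -> bool} -> dyadic (n := n)),
    E k `<=` \bigcup_(i in IP.1) dcube a L (IP.2 i) /\
    \esum_(i in IP.1) (dside L (IP.2 i) `^ delta)%:E <= (weak_cst * c k)%:E.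
  have [||I [P [cov sum]]] := @dyadic_cover R n delta a L (E k) (c k) L_gt0 (ltW delta_gt0).
  - by move=> x [].
  - by rewrite -(fineK (Efin k)) lte_fin ltrDl divr_gt0// mulr_gt0 ?exprn_gt0.
  - by exists (I, P).
move/choice : H => [IP HIP]; exists IP; split; first by move=> k; case: (HIP k).
have ws := weak_cst_ge1.
apply: (@le_trans _ _ (\esum_(k in [set: nat]) (weak_cst%:E *
   ((tau * 2 ^+ k)%:E * hcontent delta (E k) + (2 * J / (2 ^ k.+1)%:R)%:E)))).
  apply: le_esum => k _; have [_ sum] := HIP k.
  apply: (le_trans (lee_wpmul2l _ sum)).
    by rewrite lee_fin mulr_ge0 ?exprn_ge0// ltW.
  rewrite [leRHS](_ : _ = (weak_cst * (tau * 2 ^+ k * fine (hcontent delta (E k)) +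
    2 * J / (2 ^ k.+1)%:R))%:E); last first.
    by rewrite [RHS]EFinM EFinD [(tau * 2 ^+ k * fine _)%:E]EFinM fineK.
  rewrite -EFinM lee_fin /c.
  rewrite le_eqVlt; apply/orP; left; apply/eqP.
  have -> : (4 = 2 * 2 :> R)%R by ring.
  rewrite natrX exprS exprMn; field.
  by rewrite !expf_neq0// gt_eqF.
have t0 k : 0 <= (tau * 2 ^+ k)%:E * hcontent delta (E k).
  by rewrite mule_ge0 ?hcontent_ge0// lee_fin mulr_ge0 ?exprn_ge0// ltW.
have j0 k : 0 <= (2 * J / (2 ^ k.+1)%:R)%:E.
  by rewrite lee_fin divr_ge0// mulr_ge0// ltW.
rewrite esumZl; last 2 first.
- exact: lt_le_trans ws.
- by move=> k; rewrite adde_ge0.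
rewrite esumD//.
apply: (@le_trans _ _ (weak_cst%:E * ((2 * J)%:E + (2 * J)%:E))).
  apply: lee_wpmul2l; first by rewrite lee_fin (le_trans _ ws).
  apply: leeD.
    apply: (le_trans (dyadic_le_choquet delta (cube a L) f tau_gt0)).
    by rewrite EFinM; apply: lee_wpmul2l.
  rewrite -nneseries_esumT//; apply: epsilon_trick0.
  by rewrite mulr_ge0// ltW.
rewrite -EFinD -EFinM lee_fin le_eqVlt; apply/orP; left; apply/eqP.
by ring.
Qed.

(** The weights [tau 2^k] times side to the power [delta], taken over the coverings of all levels,
    have total mass at most a multiple of [J]. On a cube whose neighbors and their ancestors are all
    light, the local mass controls the integral of [f] above [tau], so the average is small. A point
    of a cube with large average thus lies in the triple of a maximal heavy cube. *)
Lemma weak_type :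
  hcontent delta [set x | exists b p, [/\ (0 < p)%R, cube b p x,
     cube b p `<=` cube a L &
     (tau * (1 + weak_cst) * p `^ delta)%:E < choquet delta (cube b p) f]] <=
  (3 `^ delta * (4 * weak_cst * J) / tau)%:E.
Proof.
have [IP [cov sum]] := covers.
pose I := [set: nat] `*`` (fun k => (IP k).1).
pose P (i : nat * (nat * {ffun 'I_n -> bool})) := (IP i.1).2 i.2.
pose w i := (tau * 2 ^+ i.1 * dside L (P i) `^ delta)%R.
have tk0 k : (0 < tau * 2 ^+ k)%R by rewrite mulr_gt0// exprn_gt0.
have w0 i : (0 <= w i)%R by rewrite mulr_ge0 ?powR_ge0// ltW.
have wsum : \esum_(i in I) (w i)%:E <= (4 * weak_cst * J)%:E.
  apply: le_trans sum.
  rewrite -(esum_esum (a := fun k i => (w (k, i))%:E)); last first.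
    by move=> *; rewrite lee_fin.
  apply: le_esum => k _; rewrite -esumZl//.
  by move=> i; rewrite lee_fin powR_ge0.
pose S := maxheavy delta L tau I P w.
have cover x : (exists b p, [/\ (0 < p)%R, cube b p x, cube b p `<=` cube a L &
     (tau * (1 + weak_cst) * p `^ delta)%:E < choquet delta (cube b p) f]) ->
  exists2 q, S q & triple a L q x.
  move=> [b [p [p0 xb bL big]]].
  have pL : (p <= L)%R.
    rewrite leNgt; apply/negP => Lp.
    have := le_hcontent delta bL; rewrite !hcontent_cube// lee_fin leNgt.
    by rewrite gt0_ltr_powR// ?nnegrE ltW.
  have [|k /andP[pk kp]] := @dyadic_level R p L; first by rewrite p0.
  pose D e := neighbor a L b k e.
  (* Ancestors are included because a covering cube larger than the neighbor is not counted in the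
     mass of that neighbor. *)
  have [[e [j [jk hj]]]|light] := pselect (exists e j,
      (j <= k)%N /\ heavy delta L tau I P w (ancestor (D e) j)).
    have [i ij mi] := heavy_maxheavy hj.
    rewrite /= in ij; have ik := leq_trans ij jk.
    rewrite ancestor_ancestor ?ij// in mi.
    exists (ancestor (D e) i) => //.
    have [e' _ xe'] := cube_neighbors a L_gt0 pk xb.
    have [y ye xy] := neighbor_shift e L_gt0 xe'.
    apply: (near_triple (y := y)); first exact: dcube_ancestor ye.
    by move=> t; apply: (le_trans (xy t)); exact: (@dside_ancestor L (D e) i L_gt0 ik).
  exfalso; move: big; apply/negP; rewrite -leNgt.
  have De e : ~ heavy delta L tau I P w (D e).
    by move=> h; apply: light; exists e, k; rewrite (ancestor_self (D e)).
  pose m k' e := \esum_(i in [set i | (IP k').1 i /\ below ((IP k').2 i) (D e)])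
    (dside L ((IP k').2 i) `^ delta)%:E.
  have Em k' e : hcontent delta (dcube a L (D e) `&` E k') <= m k' e.
    apply: (@hcontent_le_esum _ _ delta _ _
      (fun i => (a + dside L ((IP k').2 i) *: map_mx intr ((IP k').2 i).2)%R)
      (fun i => dside L ((IP k').2 i))).
      by move=> i _; exact: dside_gt0.
    move=> y [yD /cov[i Ii yi]]; exists i => //=; split => //.
    have [le|lt] := leqP (D e).1 ((IP k').2 i).1.
      by split => //; exact: ancestorE yD.
    have iE := ancestorE L_gt0 (ltnW lt) yD yi.
    exfalso; apply: light; exists e, ((IP k').2 i).1; split; first exact: ltnW.
    rewrite -iE /heavy.
    apply: (le_trans _ (@esum_ge_term _ _ _ (fun i => (w i)%:E) (k', i) _ _)).
    - rewrite lee_fin /w /P /= -mulrA ler_pM2l// ler_peMl ?powR_ge0//.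
      by rewrite exprn_ege1// ler1n.
    - by split => //; exact: belowxx.
    - by rewrite lee_fin.
  have sup k' : suplevel delta (cube b p) f (tau * 2 ^+ k') <= \sum_e m k' e.
    apply: (@le_trans _ _ (hcontent delta
       (\bigcup_(e in [set: {ffun 'I_n -> bool}]) (dcube a L (D e) `&` E k')))).
      apply: le_hcontent => y [yb fy].
      have [e _ ye] := cube_neighbors a L_gt0 pk yb.
      by exists e => //; split => //; split => //; exact: bL.
    apply: (le_trans (hcontent_bigcup _ _ _)).
    rewrite esum_finType; last by move=> e; exact: hcontent_ge0.
    by apply: lee_sum => e _.
  have m0 k' e : 0 <= m k' e by apply: esum_ge0 => i _; rewrite lee_fin powR_ge0.
  apply: (le_trans (choquet_dyadic_le _ _ _ tau_gt0)).
  (* Values below [tau] cost [tau p^delta], the 1 in [1 + weak_cst]; the [2^n] light neighbors, of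
     side less than [2 * p], cost the rest. *)
  rewrite mulrDr mulr1 mulrDl EFinD; apply: leeD.
    rewrite EFinM; apply: lee_wpmul2l; first by rewrite lee_fin ltW.
    by rewrite -(hcontent_cube b delta_gt0 delta_le p0); exact: suplevel_le.
  apply: (@le_trans _ _ (\sum_e \esum_(k' in [set: nat]) ((tau * 2 ^+ k')%:E * m k' e))).
    rewrite -esum_sum; last first.
      by move=> k' e _ _; rewrite mule_ge0// lee_fin ltW.
    apply: le_esum => k' _; rewrite -ge0_sume_distrr//.
    by apply: lee_wpmul2l; first by rewrite lee_fin ltW.
  apply: (@le_trans _ _ (\sum_(e : {ffun 'I_n -> bool}) (tau * (2 `^ delta * p `^ delta))%:E)).
    apply: lee_sum => e _.
    have -> : \esum_(k' in [set: nat]) ((tau * 2 ^+ k')%:E * m k' e) =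
        dmass I P w (D e).
      have sE : [set i | I i /\ below (P i) (D e)] = [set: nat] `*``
          (fun k' => [set i | (IP k').1 i /\ below ((IP k').2 i) (D e)]).
        by apply/seteqP; split => -[k' i] /=; [move=> [[_ ?] ?]|move=> [_ [? ?]]].
      have wE i : (w i)%:E = (w (i.1, i.2))%:E by case: i.
      rewrite /dmass sE; under [RHS]eq_esum do rewrite wE.
      rewrite -(esum_esum (a := fun k i => (w (k, i))%:E)); last first.
        by move=> *; rewrite lee_fin.
      apply: eq_esum => k' _; rewrite -esumZl//.
      by move=> i; rewrite lee_fin powR_ge0.
    have /negP := De e; rewrite /heavy -ltNge => /ltW/le_trans; apply.
    rewrite lee_fin ler_pM2l// -powRM ?(ltW p0)//.
    have De0 : (0 < dside L (D e))%R by exact: dside_gt0.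
    apply: (ge0_ler_powR (ltW delta_gt0)); last exact: ltW.
      by rewrite nnegrE ltW.
    by rewrite nnegrE mulr_ge0// ltW.
  rewrite sumEFin sumr_const card_ffun card_bool card_ord lee_fin.
  rewrite /weak_cst -mulr_natl le_eqVlt; apply/orP; left; apply/eqP; ring.
apply: (@le_trans _ _ (\esum_(q in S) ((3 * dside L q) `^ delta)%:E)).
  apply: (@hcontent_le_esum _ _ delta _ _
    (fun q => (a + dside L q *: map_mx intr q.2 - const_mx (dside L q))%R)).
    by move=> q _; rewrite mulr_gt0// dside_gt0.
  by move=> x /cover[q Sq xq]; exists q.
apply: (@le_trans _ _ (\esum_(q in S) ((3 `^ delta)%:E * (dside L q `^ delta)%:E))).
  apply: le_esum => q _; rewrite -EFinM lee_fin powRM//.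
  exact/ltW/dside_gt0.
rewrite esumZl ?powR_gt0//; last by move=> q; rewrite lee_fin powR_ge0.
rewrite -mulrA EFinM; apply: lee_wpmul2l; first by rewrite lee_fin powR_ge0.
rewrite [X in X%:E]mulrC EFinM lee_pdivlMl//.
exact: le_trans (maxheavy_sum delta L I P w0 tau_gt0) wsum.
Qed.

End one_level.
End weak_type.

(** * Level sets of the maximal function inside a cube *)

Section maximal_levels.
Local Open Scope ereal_scope.
Context {R : realType} {n : nat} (delta : R) (delta_gt0 : (0 < delta)%R)
  (delta_le : (delta <= n%:R)%R).
Implicit Types (a b x : 'rV[R]_n) (l p : R).

(** [4 * weak_cst] and one [3^delta] come from [weak_type], the other [3^delta] from integrating
    over [3Q], and [1 + weak_cst] from the choice of [tau]. *)
Definition level_cst : R :=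
  (4 * 3 `^ delta * 3 `^ delta * weak_cst delta (n := n) * (1 + weak_cst delta (n := n)))%R.

Let W : R := weak_cst delta (n := n).
Let W1 : (1 <= W)%R. Proof. exact: weak_cst_ge1. Qed.
Let T1 : (1 <= 3 `^ delta :> R)%R.
Proof. by rewrite -[leLHS](powRr0 3) ler_powR ?ler1n// ltW. Qed.

Lemma level_cst_ge : (3 `^ delta <= level_cst)%R.
Proof.
rewrite /level_cst -/W; set t := (3 `^ delta)%R.
have t1 : (1 <= t)%R := T1.
have w1 := W1.
rewrite -[leLHS]mulr1 (_ : (4 * t * t * W * (1 + W))%R = (t * (4 * t * W * (1 + W)))%R);
  last by ring.
rewrite ler_pM2l; last by lra.
have h1 : (1 <= t * W)%R by rewrite -[leLHS]mulr1 ler_pM.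
have h2 : (1 <= t * W * (1 + W))%R by rewrite -[leLHS]mulr1 ler_pM//; lra.
lra.
Qed.

Lemma level_cst_gt0 : (0 < level_cst)%R.
Proof. by apply: lt_le_trans level_cst_ge; rewrite powR_gt0. Qed.

(* A cube through a point of Q is either of side at least l, and then its average is
   controlled by m after enlarging it over Q, or it is contained in 3Q, where
   the weak type estimate applies. *)
Lemma maximal_level (g : 'rV[R]_n -> \bar R) a l (m : R) :
  (0 < l)%R -> (0 < m)%R ->
  (forall b p, (0 < p)%R -> cube a l `<=` cube b p ->
     choquet delta (cube b p) (fun y => `|g y|) <= (m * p `^ delta)%:E) ->
  forall k, hcontent delta [set x | cube a l x /\ (m * 2 ^+ k)%:E < maximal delta g x]
    <= (level_cst * l `^ delta / 2 ^+ k)%:E.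
Proof.
move=> l0 m0 bnd k; have ld0 : (0 < l `^ delta)%R by rewrite powR_gt0.
have k0 : (0 < 2 ^+ k :> R)%R by rewrite exprn_gt0.
(* Below [3^delta] the bound is trivial by [level_cst_ge]. From [3^delta] on, cubes of side at least
   [l] cannot exceed the level: their average is at most [3^delta m]. *)
have [small|big] := ltP (2 ^+ k)%R (3 `^ delta)%R.
  apply: (@le_trans _ _ (hcontent delta (cube a l))).
    by apply: le_hcontent => x [].
  rewrite hcontent_cube// lee_fin ler_pdivlMr// mulrC ler_pM2r//.
  exact: le_trans (ltW small) level_cst_ge.
pose lam : R := (m * 2 ^+ k)%R.
have lam0 : (0 < lam)%R by rewrite mulr_gt0.
pose tau : R := (lam / (1 + W))%R.
have W10 : (0 < 1 + W)%R by have := W1; lra.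
have tau0 : (0 < tau)%R by rewrite divr_gt0.
pose a3 := (a - const_mx l)%R.
have sub3 : cube a l `<=` cube a3 (3 * l).
  move=> x xa i; have /andP[h1 h2] := xa i; rewrite !mxE.
  by apply/andP; split; lra.
have l30 : (0 < 3 * l)%R by rewrite mulr_gt0.
pose J : R := (m * (3 * l) `^ delta)%R.
have J0 : (0 < J)%R by rewrite mulr_gt0// powR_gt0.
have := weak_type delta_gt0 delta_le l30 J0 tau0 (bnd _ _ l30 sub3).
have tauE : (tau * (1 + weak_cst delta (n := n)) = lam)%R.
  by rewrite /tau divfK// gt_eqF.
rewrite tauE => weak.
apply: (@le_trans _ _ (3 `^ delta * (4 * weak_cst delta (n := n) * J) / tau)%:E);
    last first.
  rewrite lee_fin le_eqVlt; apply/orP; left; apply/eqP.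
  rewrite /J /tau /lam /level_cst -/W powRM ?(ltW l0)//; field.
  by rewrite !gt_eqF.
apply: le_trans weak; apply: le_hcontent => x [xa /ereal_sup_gt].
move=> [_ [b [p [p0 xb ->]]]]; rewrite ltNge average_le// -ltNge => lt.
exists b, p; split => // y yb i.
have [lp|pl] := leP l p; last first.
  have /andP[h1 h2] := xa i; have /andP[h3 h4] := xb i.
  have /andP[h5 h6] := yb i; rewrite !mxE.
  by apply/andP; split; lra.
exfalso; move: lt; apply/negP; rewrite -leNgt.
pose b3 := (b - const_mx p)%R.
have p30 : (0 < 3 * p)%R by rewrite mulr_gt0.
have sub : cube a l `<=` cube b3 (3 * p).
  move=> z za j; have /andP[h1 h2] := xa j; have /andP[h3 h4] := xb j.
  have /andP[h5 h6] := za j; rewrite !mxE.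
  by apply/andP; split; lra.
apply: (@le_trans _ _ (choquet delta (cube b3 (3 * p)) (fun y => `|g y|))).
  apply: le_choquet => t _; apply: le_hcontent => z [zb zt]; split => // j.
  by have /andP[h1 h2] := zb j; rewrite !mxE; apply/andP; split; lra.
apply: (le_trans (bnd _ _ p30 sub)); rewrite lee_fin powRM ?(ltW p0)// mulrA.
by rewrite ler_pM2r ?powR_gt0// ler_pM2l.
Qed.

(** If every cube around [cube a l] had average 0, Chebyshev would make each [{|g| > 1 / (j + 1)}]
    null on cubes exhausting the space. A positive average bounds [M g] from below on all of
    [cube a l]. *)
Lemma maximal_bounded_below (g : 'rV[R]_n -> \bar R) a l : (0 < l)%R ->
  ~ hae delta (fun x => g x = 0) ->
  exists b p, [/\ (0 < p)%R, cube a l `<=` cube b p &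
    0 < average delta (cube b p) (fun y => `|g y|)].
Proof.
move=> l0 gN0; apply: contrapT => none; apply: gN0.
pose B (k : nat) : 'rV[R]_n := (a - const_mx k%:R)%R.
pose P (k : nat) : R := (l + 2 * k%:R)%R.
have P0 k : (0 < P k)%R by rewrite ltr_wpDr// mulr_ge0.
pose F (i : nat * nat) := [set x | cube (B i.1) (P i.1) x /\ (i.2.+1%:R^-1)%:E < `|g x|].
apply: (@hcontent0_subset _ _ _ _ (\bigcup_(i in setT) F i)).
  move=> x gx.
  have [k xk] : exists k, cube (B k) (P k) x.
    pose d i : R := (x 0 i - a 0 i)%R.
    exists (\sum_i Num.bound `|d i|%R)%N => i; rewrite !mxE.
    have : (`|d i| < (\sum_i Num.bound `|d i|%R)%N%:R)%R.
      apply: (lt_le_trans (archi_boundP (normr_ge0 _))).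
      by rewrite ler_nat (bigD1 i)//= leq_addr.
    rewrite /P ltr_norml; set M : R := (_%:R)%R; rewrite /d => /andP[h1 h2].
    by apply/andP; split; lra.
  have g0 : 0 < `|g x| by rewrite lt0e abse_ge0 abse_eq0 andbT; apply/eqP.
  have [j gj] : exists j : nat, (j.+1%:R^-1)%:E < `|g x|.
    have := g0; case: `|g x| => [r| |]; rewrite ?lte_fin.
    - move=> r0; exists (Num.bound r^-1); rewrite lte_fin invf_plt ?posrE//.
      apply: (lt_le_trans (archi_boundP _)); first by rewrite invr_ge0 ltW.
      by rewrite ler_nat.
    - by move=> _; exists 0%N; rewrite ltry.
    - by [].
  by exists (k, j).
apply: hcontent0_bigcup => -[k j] _.
have sub : cube a l `<=` cube (B k) (P k).
  move=> x xa i; have /andP[h1 h2] := xa i; rewrite /P !mxE.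
  have := ler0n R k => k0.
  by apply/andP; split; lra.
have c0 : choquet delta (cube (B k) (P k)) (fun y => `|g y|) <= 0.
  have := @average_le _ _ _ delta_gt0 delta_le (B k) (P k) (fun y => `|g y|) 0%R (P0 k).
  rewrite mul0r => <-; rewrite leNgt; apply/negP => av.
  by apply: none; exists (B k), (P k).
have j0 : (0 < (j.+1%:R^-1 : R))%R by rewrite invr_gt0.
have := le_trans (chebyshev delta (cube (B k) (P k)) (fun y => `|g y|) j0) c0.
rewrite pmule_rle0// => h; apply/eqP; rewrite eq_le hcontent_ge0 andbT.
exact: h.
Qed.

End maximal_levels.

(** * The logarithm of the maximal function *)

Section log_maximal.
Local Open Scope ereal_scope.
Context {R : realType} {n : nat} (delta : R) (delta_gt0 : (0 < delta)%R)
  (delta_le : (delta <= n%:R)%R).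
Context (alpha B : R) (b g : 'rV[R]_n -> \bar R) (alpha_gt0 : (0 < alpha)%R)
  (B_gt0 : (0 < B)%R) (b_le : hae delta (fun x => `|b x| <= B%:E))
  (g_neq0 : ~ hae delta (fun x => g x = 0))
  (Mg_fin : hae delta (fun x => maximal delta g x < +oo)).
Implicit Types (a : 'rV[R]_n) (l p : R).

Let Mg := maximal delta g.
Let f x := alpha%:E * lne (Mg x) + b x.

Definition inf_maximal a l : R := fine (ereal_inf (Mg @` cube a l)).

Let good x := Mg x < +oo /\ `|b x| <= B%:E.

Let good_ae : hae delta good.
Proof.
apply/eqP; rewrite eq_le hcontent_ge0 andbT -[leRHS]b_le.
apply: hcontent_null_setU Mg_fin => x /= /not_andP[h|h]; [right|left]; exact: h.
Qed.

(** A cube containing [cube a l] competes in the supremum at each of its points, so its average is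
    at most the infimum. The infimum is finite because a cube is not null and hence contains a point
    where [M g] is finite. *)
Lemma inf_maximalP a l : (0 < l)%R ->
  [/\ (0 < inf_maximal a l)%R,
    forall x, cube a l x -> (inf_maximal a l)%:E <= Mg x &
    forall c p, (0 < p)%R -> cube a l `<=` cube c p ->
      choquet delta (cube c p) (fun y => `|g y|) <=
        (inf_maximal a l * p `^ delta)%:E].
Proof.
move=> l0.
have sup c p : (0 < p)%R -> cube a l `<=` cube c p ->
    average delta (cube c p) (fun y => `|g y|) <= ereal_inf (Mg @` cube a l).
  move=> p0 sub; apply: le_ereal_inf_tmp => _ [x xa <-].
  by apply: average_le_maximal => //; exact: sub.
have [c [p [p0 sub av]]] := maximal_bounded_below delta_gt0 delta_le a l0 g_neq0.
have pos := lt_le_trans av (sup _ _ p0 sub).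
have fin : ereal_inf (Mg @` cube a l) < +oo.
  have : exists x, cube a l x /\ Mg x < +oo.
    apply: contrapT => none.
    have := hcontent_cube_gt0 delta_gt0 delta_le a l0; rewrite lt_neqAle => /andP[/eqP+ _].
    apply; apply/esym; apply: hcontent0_subset Mg_fin => x xa /= h.
    by apply: none; exists x.
  move=> [x [xa]]; apply: le_lt_trans.
  by apply: ereal_inf_lbound; exists x.
have mE : (inf_maximal a l)%:E = ereal_inf (Mg @` cube a l).
  by rewrite fineK// fin_numElt (lt_trans _ pos)// ltNyr.
split.
- by rewrite -lte_fin mE.
- by move=> x xa; rewrite mE; apply: ereal_inf_lbound; exists x.
- by move=> c' p' p'0 sub'; rewrite -average_le// mE; exact: sup.
Qed.

Let f_good a l x : (0 < l)%R -> cube a l x -> good x ->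
  exists y c : R, [/\ Mg x = y%:E, f x = (alpha * ln y + c)%:E,
    (inf_maximal a l <= y)%R & (`|c| <= B)%R].
Proof.
move=> l0 xa [Mx bx]; have [m0 mM _] := inf_maximalP a l0.
have Mxfin : Mg x \is a fin_num.
  by rewrite fin_numElt Mx andbT (lt_le_trans _ (mM x xa))// ltNyr.
have bfin : b x \is a fin_num.
  by rewrite fin_num_abs (le_lt_trans bx)// ltry.
have my : (inf_maximal a l <= fine (Mg x))%R by rewrite -lee_fin (fineK Mxfin) mM.
exists (fine (Mg x)), (fine (b x)); split => //.
- by rewrite fineK.
- rewrite /f -[in LHS](fineK Mxfin) lne_EFin; last exact: lt_le_trans my.
  by rewrite EFinD EFinM (fineK bfin).
- by move: bx; rewrite -(fineK bfin).
Qed.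

(** Common core of the oscillation bound and of local integrability. Exceeding [k >= 1] steps of
    size [W + alpha ln 2] forces [M g > 2^k m], since a single [W] absorbs the additive term;
    [maximal_level] then supplies the decay. *)
Lemma choquet_log_maximal_le (F : 'rV[R]_n -> \bar R) a l (W : R) (E0 : set 'rV[R]_n) :
  (0 < l)%R -> (0 <= W)%R -> hcontent delta E0 = 0 ->
  (forall x y c, cube a l x -> ~ E0 x -> Mg x = y%:E -> f x = (alpha * ln y + c)%:E ->
     (inf_maximal a l <= y)%R -> (`|c| <= B)%R ->
     F x <= (alpha * ln (y / inf_maximal a l) + W)%:E) ->
  choquet delta (cube a l) F <=
    (2 * (W + alpha * ln 2) * (level_cst delta (n := n) * l `^ delta))%:E.
Proof.
move=> l0 W0 E0null bnd.
have [m0 mM mavg] := inf_maximalP a l0; set m := inf_maximal a l in m0 mM mavg bnd.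
have ln2_gt0 : (0 < ln 2 :> R)%R by rewrite ln_gt0// ltr1n.
have al0 : (0 < alpha * ln 2)%R by rewrite mulr_gt0.
have ld0 : (0 < l `^ delta)%R by rewrite powR_gt0.
have L0 : (0 < level_cst delta (n := n))%R by exact: level_cst_gt0.
have L1 : (1 <= level_cst delta (n := n))%R.
  apply: le_trans (@level_cst_ge R n delta delta_gt0).
  by rewrite -[leLHS](powRr0 3) ler_powR ?ler1n// ltW.
apply: choquet_exp_le.
- by rewrite ltr_wpDl.
- by rewrite mulr_ge0// ltW.
move=> [|k].
  apply: (le_trans (suplevel_le _ _ _ _)).
  rewrite hcontent_cube// expr0 divr1 lee_fin.
  by rewrite ler_peMl// ltW.
apply: le_trans (maximal_level delta_gt0 delta_le l0 m0 mavg k.+1).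
have null : hcontent delta (E0 `|` [set x | ~ good x]) = 0.
  apply/eqP; rewrite eq_le hcontent_ge0 andbT.
  by apply: le_trans (hcontent_setU _ _ _) _; rewrite E0null good_ae adde0.
apply: hcontent_null_setU null => x [xa Fx].
have [xE|nE] := pselect (E0 x); first by right; left.
have [gx|ngx] := pselect (good x); last by right; right.
left; split => //.
have [y [c [My fy my cB]]] := f_good l0 xa gx.
have y0 : (0 < y)%R by exact: lt_le_trans my.
rewrite -/(Mg x) My lte_fin mulrC -ltr_pdivlMr//.
have := lt_le_trans Fx (bnd x y c xa nE My fy my cB).
rewrite lte_fin -/m => h.
rewrite -ltr_ln ?posrE ?exprn_gt0 ?divr_gt0// lnXn// -(ltr_pM2l alpha_gt0).
rewrite -(ltrD2r W); apply: le_lt_trans h.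
rewrite mulrnAr mulrnDl addrC lerD2r.
by rewrite mulrS lerDl mulrn_wge0.
Qed.

Lemma hess_inf_log_maximal a l : (0 < l)%R ->
  [/\ hess_inf delta (cube a l) f \is a fin_num &
      (alpha * ln (inf_maximal a l) - B)%:E <= hess_inf delta (cube a l) f].
Proof.
move=> l0; have [m0 mM mavg] := inf_maximalP a l0.
have lb : (alpha * ln (inf_maximal a l) - B)%:E <= hess_inf delta (cube a l) f.
  apply: le_ereal_inf_tmp => _ [t /= Ht <-]; rewrite leNgt; apply/negP => lt.
  move: Ht; apply/negP; rewrite -leNgt -[leRHS]good_ae.
  apply: le_hcontent => x [xa ft] gx.
  have [y [c [My fy my cB]]] := f_good l0 xa gx.
  move: ft; apply/negP; rewrite -leNgt fy; apply: le_trans (ltW lt) _.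
  have y0 : (0 < y)%R by exact: lt_le_trans my.
  have lny : (alpha * ln (inf_maximal a l) <= alpha * ln y)%R.
    by rewrite ler_pM2l// ler_ln ?posrE.
  by move: cB; rewrite ler_norml => /andP[h1 h2]; rewrite lee_fin; lra.
split => //; rewrite fin_numElt (lt_le_trans _ lb) ?ltNyr//=.
apply: (hess_inf_lty delta_gt0 delta_le l0).
apply: hcontent0_subset good_ae => x [xa fx] gx; apply: fx.
by have [y [c [_ -> _ _]]] := f_good l0 xa gx.
Qed.

(** Here [W = 2 * B]: one [B] bounds [b] at the point, the other comes from the lower bound for the
    essential infimum. *)
Lemma choquet_oscillation_log_maximal a l : (0 < l)%R ->
  choquet delta (cube a l) (fun x => `|f x - hess_inf delta (cube a l) f|) <=
    (2 * (2 * B + alpha * ln 2) * (level_cst delta (n := n) * l `^ delta))%:E.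
Proof.
move=> l0; have [hfin hlb] := hess_inf_log_maximal a l0.
have [m0 _ _] := inf_maximalP a l0.
apply: (choquet_log_maximal_le l0 _ (hess_inf_null delta (cube a l) f)).
  by rewrite mulr_ge0// ltW.
move=> x y c xa nlow My fy my cB.
have hf : hess_inf delta (cube a l) f <= f x.
  by rewrite leNgt; apply/negP => h; apply: nlow.
have y0 : (0 < y)%R by exact: lt_le_trans my.
rewrite gee0_abs; last by rewrite sube_ge0// hfin.
move: hlb; rewrite -(fineK hfin) fy lee_fin -EFinB lee_fin.
rewrite ln_div ?posrE// mulrBr.
by move: cB; rewrite ler_norml => /andP[h1 h2] h; lra.
Qed.

Lemma L1loc_log_maximal : L1loc delta f.
Proof.
move=> K cK; have [a [l [l0 Kal]]] := compact_subset_cube cK.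
apply: (@le_lt_trans _ _ (choquet delta (cube a l) (fun x => `|f x|))).
  by apply: le_choquet => t _; apply: le_hcontent => x [/Kal].
have [m0 _ _] := inf_maximalP a l0.
apply: le_lt_trans (_ : _ <= (2 * ((`|alpha * ln (inf_maximal a l)| + B) + alpha * ln 2) *
   (level_cst delta (n := n) * l `^ delta))%:E) _; last exact: ltry.
apply: (choquet_log_maximal_le (E0 := set0) l0) => //.
- by rewrite addr_ge0// ltW.
- by apply: hcontent0_subset good_ae => x.
move=> x y c xa _ My fy my cB; rewrite fy lee_fin.
have y0 : (0 < y)%R by exact: lt_le_trans my.
have -> : (alpha * ln y + c =
  alpha * ln (y / inf_maximal a l) + (alpha * ln (inf_maximal a l) + c))%R.
  by rewrite ln_div ?posrE//; ring.
apply: (le_trans (ler_normD _ _)); apply: lerD.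
  rewrite ger0_norm// mulr_ge0 ?(ltW alpha_gt0)// ln_ge0//.
  by rewrite ler_pdivlMr// mul1r.
by apply: (le_trans (ler_normD _ _)); apply: lerD.
Qed.

End log_maximal.

Lemma BLO_log_maximal {R : realType} {n : nat} {delta : R} :
  0 < delta -> delta <= n%:R ->
  exists C : R, 0 < C /\
    forall (alpha : R) (b g : 'rV[R]_n -> \bar R),
      0 < alpha -> Linfty delta b -> L1loc delta g ->
      ~ hae delta (fun x => g x = 0%E) ->
      hae delta (fun x => (maximal delta g x < +oo)%E) ->
      let f := fun x => (alpha%:E * lne (maximal delta g x) + b x)%E in
      BLO delta f /\
      (BLO_norm delta f <= C%:E * (alpha%:E + Linfty_norm delta b))%E.
Proof.
move=> d0 dn; pose L : R := level_cst delta (n := n).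
have L0 : 0 < L by exact: level_cst_gt0.
have ln2_gt0 : 0 < ln 2 :> R by rewrite ln_gt0// ltr1n.
pose C : R := 2 * (2 + ln 2) * L.
exists C; split; first by rewrite /C mulr_gt0// mulr_gt0// addr_gt0.
move=> alpha b g alpha0 bL _ gN0 Mfin f.
have b0 : (0 <= Linfty_norm delta b)%E.
  by apply: le_ereal_inf_tmp => _ [t [t0 _] <-]; rewrite lee_fin ltW.
have bE : Linfty_norm delta b = (fine (Linfty_norm delta b))%:E.
  by rewrite fineK// ge0_fin_numE.
set beta := fine _ in bE.
have beta0 : 0 <= beta by rewrite -lee_fin -bE.
(* The norm [beta] may be 0; the slack [alpha] gives a positive bound that holds almost everywhere
   and is absorbed into the constant. *)
pose B := beta + alpha.
have B0 : 0 < B by rewrite ltr_wpDl.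
have bB : hae delta (fun x => (`|b x| <= B%:E)%E).
  have : (Linfty_norm delta b < B%:E)%E by rewrite bE lte_fin ltrDl.
  move=> /ereal_inf_lt[_ [t [t0 tnull] <-]]; rewrite lte_fin => tB.
  apply: hcontent0_subset tnull => x /= /negP; rewrite -ltNge.
  by apply: lt_trans; rewrite lte_fin.
have normf : (BLO_norm delta f <= C%:E * (alpha%:E + Linfty_norm delta b))%E.
  rewrite bE -EFinD -EFinM; apply: ge_ereal_sup => _ [a [l [l0 ->]]].
  rewrite average_le//.
  apply: (le_trans (choquet_oscillation_log_maximal d0 dn alpha0 B0 bB gN0 Mfin a l0)).
  rewrite lee_fin mulrA ler_pM2r ?powR_gt0// -/L /C.
  rewrite [leRHS](_ : _ = 2 * ((2 + ln 2) * (alpha + beta)) * L); last by ring.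
  rewrite ler_pM2r// ler_pM2l// /B.
  have := mulr_ge0 (ltW ln2_gt0) beta0 => h; nra.
split => //; split.
  exact (L1loc_log_maximal d0 dn alpha0 B0 bB gN0 Mfin).
by apply: le_lt_trans normf _; rewrite bE -EFinD -EFinM ltry.
Qed.

Unset Implicit Arguments.

Theorem theorem1p8 (R : realType) (n : nat) (delta : R)
    (delta_gt0 : 0 < delta) (delta_len : delta <= n%:R) :
  (exists C : R, 0 < C /\
    forall f : 'rV[R]_n -> \bar R,
      BLO delta f -> BLO_norm delta f <> 0%E ->
      exists (alpha : R) (b g : 'rV[R]_n -> R),
        [/\ 0 < alpha,
            Linfty delta (EFin \o b),
            L1loc delta (EFin \o g),
            hae delta (fun x =>
              f x = (alpha%:E * lne (maximal delta (EFin \o g) x)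
                     + (b x)%:E)%E) &
            (alpha%:E + Linfty_norm delta (EFin \o b)
             <= C%:E * BLO_norm delta f)%E])
  /\
  (exists C : R, 0 < C /\
    forall (alpha : R) (b g : 'rV[R]_n -> \bar R),
      0 < alpha -> Linfty delta b -> L1loc delta g ->
      ~ hae delta (fun x => g x = 0%E) ->
      hae delta (fun x => (maximal delta g x < +oo)%E) ->
      let f := fun x => (alpha%:E * lne (maximal delta g x) + b x)%E in
      BLO delta f /\
      (BLO_norm delta f <= C%:E * (alpha%:E + Linfty_norm delta b))%E).
Proof.
split; [exact: BLO_decomposition | exact: BLO_log_maximal].
Qed.
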